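(* Let $P\subseteq\mathbb{R}^d$ and $Q\subseteq\mathbb{R}^e$ be full-dimensional polytopes. Then (a) $I_{P\vee Q}\subseteq T_{P\vee Q}$ if and only if $I_P\subseteq T_P$ and $I_Q\subseteq T_Q$; (b) $T_{P\vee Q}\subseteq I_{P\vee Q}$ if and only if $T_P\subseteq I_P$ and $T_Q\subseteq I_Q$; (c) in particular, $P\vee Q$ is graphic if and only if $P$ and $Q$ are graphic.
   Context: Join: embed $P,Q$ in $\mathbb{R}^{d+e+1}$ with disjoint affine spans whose direction spaces intersect trivially; $P\vee Q$ is the convex hull of the union. Its symbolic slack matrix is $\begin{bmatrix} S_P(\mathbf x)&0\\0&S_Q(\mathbf y)\end{bmatrix}$ with disjoint variable sets $\mathbf x,\mathbf y$. For a $D$-polytope $R$ with facets $F_i$ (given by affine $h_i\ge0$ vanishing on $F_i$) and vertices $v_j$, the symbolic slack matrix $S_R(\mathbf z)$ replaces each nonzero entry of $[h_i(v_j)]$ (pairs with $v_j\notin F_i$) by a distinct variable; $I_R$ is the ideal of $(D+2)$-minors of $S_R$ saturated by the product of all variables. The non-incidence graph $\mathbf G_R$ is bipartite on facets $\sqcup$ vertices, edge $\{F,v\}$ iff $v\notin F$, labeled by the variable at $(F,v)$. For a directed cycle $C$, $f_C$ = (product of labels of edges directed facet$\to$vertex) $-$ (product of labels of edges directed vertex$\to$facet). $T_R$ is generated by $f_C$ over chordless cycles of $\mathbf G_R$. $R$ is graphic if $I_R=T_R$. *)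

(* Defs.v *)
From mathcomp Require Import all_boot all_order all_algebra.
From mathcomp Require Import boolp classical_sets reals mpoly.

Set Implicit Arguments.
Unset Strict Implicit.
Unset Printing Implicit Defensive.

Import Order.TTheory GRing.Theory Num.Theory.

Local Open Scope classical_set_scope.
Local Open Scope ring_scope.

Section Polytopes.
Variables (R : realType) (n : nat).
Implicit Types (A P F : set 'rV[R]_n) (h : 'cV[R]_n * R).

Definition conv A : set 'rV[R]_n :=
  [set x | exists k (p : 'I_k -> 'rV[R]_n) (a : 'I_k -> R),
     [/\ forall i, A (p i), forall i, 0 <= a i,
         \sum_i a i = 1 & x = \sum_i a i *: p i]].

Definition is_polytope P := exists s : seq 'rV[R]_n, P = conv [set` s].

(* A maximal affinely independent family in A has r points, i.e. A has affine
   dimension r - 1, with the convention that set0 has dimension -1; points x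
   are homogenized to (1, x). *)
Definition affine_rank A (r : nat) :=
  exists B : 'M[R]_(r, 1 + n),
    [/\ row_free B,
        forall i, exists2 x, A x & row i B = row_mx 1%:M x &
        forall x, A x -> (row_mx 1%:M x <= B)%MS].

Definition full_dimensional P := affine_rank P n.+1.

(* The pair h stands for the affine function x |-> x *m h.1 + h.2. *)
Definition aff h (x : 'rV[R]_n) : R := (x *m h.1) 0 0 + h.2.

Definition valid_on P h := forall x, P x -> 0 <= aff h x.

Definition zeros_in P h : set 'rV[R]_n := [set x | P x /\ aff h x = 0].

(* P itself (h = 0) and set0 (h = 1) count as faces. *)
Definition is_face P F := exists2 h, valid_on P h & F = zeros_in P h.

(* The only facet of a single point is thus its empty face. *)
Definition is_facet P F :=
  is_face P F /\ exists r, affine_rank P r.+1 /\ affine_rank F r.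

Definition is_vertex P (v : 'rV[R]_n) := is_face P [set v].

Definition is_slack_matrix P (m k : nat) (S : 'M[R]_(m, k)) :=
  exists (h : 'I_m -> 'cV[R]_n * R) (v : 'I_k -> 'rV[R]_n),
    [/\ [/\ forall i, valid_on P (h i),
            forall F, is_facet P F <-> exists i, F = zeros_in P (h i) &
            injective (fun i => zeros_in P (h i))],
        (forall x, is_vertex P x <-> exists j, x = v j) /\ injective v &
        S = \matrix_(i, j) aff (h i) (v j)].

End Polytopes.

(* x |-> x *m A + a and y |-> y *m B + b are the two embeddings; the ranges of
   these maps are the affine spans of the images of P and Q when P and Q are
   full-dimensional. *)
Definition is_join (R : realType) (d e : nat)
    (P : set 'rV[R]_d) (Q : set 'rV[R]_e) (J : set 'rV[R]_(d + e + 1)) :=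
  exists (A : 'M[R]_(d, d + e + 1)) (a : 'rV[R]_(d + e + 1))
         (B : 'M[R]_(e, d + e + 1)) (b : 'rV[R]_(d + e + 1)),
    [/\ row_free A /\ row_free B,
        forall x y, x *m A + a <> y *m B + b,
        (A :&: B)%MS = 0 &
        J = conv ([set x *m A + a | x in P] `|` [set y *m B + b | y in Q])].

Section Ideals.
Variable A : comPzRingType.

Definition ideal_gen (G : set A) : set A :=
  [set f | exists k (c g : 'I_k -> A),
     (forall i, G (g i)) /\ f = \sum_i c i * g i].

Definition saturation (I : set A) (g : A) : set A :=
  [set f | exists N, I (g ^+ N * f)].

Definition minors (m n r : nat) (M : 'M[A]_(m, n)) : set A :=
  [set f | exists (rs : 'I_r -> 'I_m) (cs : 'I_r -> 'I_n),
     [/\ {homo rs : i j / (i < j)%N}, {homo cs : i j / (i < j)%N} &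
         f = \det (mxsub rs cs M)]].

End Ideals.

Section Slack.
Variables (R : realType) (K : fieldType) (m n : nat) (S : 'M[R]_(m, n)).

Definition nonzeros : {set 'I_m * 'I_n} := [set p | S p.1 p.2 != 0].

Definition symbolic_slack : 'M[{mpoly K[#|nonzeros|]}]_(m, n) :=
  \matrix_(i, j)
    if [pick k : 'I_#|nonzeros| | enum_val k == (i, j)] is Some k
    then 'X_k else 0.

(* D is the dimension of the polytope with slack matrix S. *)
Definition slack_ideal (D : nat) : set {mpoly K[#|nonzeros|]} :=
  saturation (ideal_gen (minors (D + 2) symbolic_slack))
             (\prod_(k < #|nonzeros|) 'X_k).

(* Nodes inl i are the facets (rows), nodes inr j the vertices (columns). *)
Definition nonincident : rel ('I_m + 'I_n) := fun x y =>
  match x, y with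
  | inl i, inr j | inr j, inl i => S i j != 0
  | _, _ => false
  end.

Definition edge_label (x y : 'I_m + 'I_n) : {mpoly K[#|nonzeros|]} :=
  match x, y with
  | inl i, inr j | inr j, inl i => symbolic_slack i j
  | _, _ => 1
  end.

Definition is_facet_node (x : 'I_m + 'I_n) : bool :=
  if x is inl _ then true else false.

(* The cycle is directed from x to next c x. *)
Definition chordless_cycle (c : seq ('I_m + 'I_n)) :=
  [/\ ucycle nonincident c, (2 < size c)%N &
      {in c &, forall x y, nonincident x y -> y = next c x \/ x = next c y}].

Definition cycle_binomial (c : seq ('I_m + 'I_n)) : {mpoly K[#|nonzeros|]} :=
  \prod_(x <- c | is_facet_node x) edge_label x (next c x)
  - \prod_(x <- c | ~~ is_facet_node x) edge_label x (next c x).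

Definition cycle_ideal : set {mpoly K[#|nonzeros|]} :=
  ideal_gen [set cycle_binomial c | c in chordless_cycle].

Definition graphic (D : nat) := slack_ideal D = cycle_ideal.

End Slack.

Arguments slack_ideal {R} K {m n} S D _.
Arguments cycle_ideal {R} K {m n} S _.
Arguments graphic {R} K {m n} S D.

(* Main.v *)
(* Write a join of P and Q in homogeneous coordinates: the spans of P and Q become
   complementary, so ranks of faces add up, and the facets of the join are the joins of
   a facet of one factor with the other factor. Hence its slack matrix has block diagonal
   support, its symbolic slack matrix lives in C = K[x, y], and a chordless cycle of its
   non-incidence graph lies in one block: T_J = T_P C + T_Q C.
   Also I_J = I_P C + I_Q C. A (d + e + 3)-minor uses d + 2 rows of P or e + 2 rows of Q,
   so Laplace expansion puts it in I_P C + I_Q C, an ideal which is saturated because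
   C is the tensor product of K[x] and K[y] over a field. Conversely a maximal flag of faces
   of Q gives a triangular (e + 1)-minor of its symbolic slack matrix, a monomial, whose
   product with a (d + 2)-minor of P is a minor of the join.
   Sending y to 1 maps T_J to T_P and recovers I_P <= T_P from I_J <= T_J. In the other
   direction, (I_P C + I_Q C) meets K[x] in I_P as soon as 1 is not in I_Q; since the minors
   have integer coefficients this descends from K to the rationals, where the real slack
   matrix is a zero of the minors with nonzero entries. *)
From HB Require Import structures.
Require Import Defs.
From mathcomp Require Import all_boot all_order all_fingroup all_algebra.
From mathcomp Require Import boolp classical_sets reals mpoly.
From mathcomp Require Import ring zify.

Set Implicit Arguments.
Unset Strict Implicit.
Unset Printing Implicit Defensive.

Import Order.TTheory GRing.Theory Num.Theory.

Local Open Scope classical_set_scope.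
Local Open Scope ring_scope.

(** * Flags of faces of a vector configuration *)

(** The converses of (a) and (b) need different arguments. Setting y to 1 kills T_Q but need not
    kill I_Q, because the 0/1 matrix with the support of the slack matrix of Q can have rank above e
    + 1. So a membership in I_P C + I_Q C is contracted to K[x] by linear algebra over K. Properness
    of I_Q is essential there: if I_Q were K[y], then I_J would be the whole ring for every P. The
    tensor product is never constructed. A list of pairs (a_i, b_i) stands for the sum of the a_i
    b_i. If the b_i are independent modulo I_Q, this sum lies in I_P C + I_Q C only if every a_i
    lies in I_P; saturation and contraction both follow from this. The size d + e + 3 is read in two
    ways. As (d + 1) + (e + 1) + 1 it gives the pigeonhole on rows; as (d + 2) + (e + 1) it fits a
    minor of P next to a triangular minor of Q, whose monomial value is then removed by saturation.
    Zero sets of functionals on a finite list of vectors stand for faces, so flags need no face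
    lattice. Lemmas are mostly stated for the left factor and reused for the right one by a swap. *)

Section VectorConfiguration.
Variables (R : realType) (l N : nat) (u : 'I_l -> 'rV[R]_N).
Implicit Types (S T : {set 'I_l}) (c g h : 'cV[R]_N) (k : 'I_l).

Definition val_at c k : R := (u k *m c) 0 0.

Lemma val_atD c g k : val_at (c + g) k = val_at c k + val_at g k.
Proof. by rewrite /val_at mulmxDr mxE. Qed.

Lemma val_atN c k : val_at (- c) k = - val_at c k.
Proof. by rewrite /val_at mulmxN mxE. Qed.

Lemma val_atZ a c k : val_at (a *: c) k = a * val_at c k.
Proof. by rewrite /val_at -scalemxAr mxE. Qed.

Definition nonneg_on S c := forall k, k \in S -> 0 <= val_at c k.

Definition zero_set c : {set 'I_l} := [set k | val_at c k == 0].

(** Rows outside [S] are zeroed instead of deleted, so all subfamilies share one matrix size and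
    [\rank] still measures the span of the selected vectors. *)
Definition fam S : 'M[R]_(l, N) := \matrix_(k < l) (if k \in S then u k else 0).

Lemma fam_sub m S (W : 'M[R]_(m, N)) :
  (fam S <= W)%MS <-> forall k, k \in S -> (u k <= W)%MS.
Proof.
split=> [sub k kS|sub]; last first.
  by apply/row_subP=> k; rewrite rowK; case: ifP => [/sub|_] //; exact: sub0mx.
apply: submx_trans sub; have := row_sub k (fam S); by rewrite rowK kS.
Qed.

Lemma mem_fam S k : k \in S -> (u k <= fam S)%MS.
Proof. exact: ((fam_sub S (fam S)).1 (submx_refl _) k). Qed.

Lemma famS S T : S \subset T -> (fam S <= fam T)%MS.
Proof. by move=> /fintype.subsetP ST; apply/fam_sub => k /ST; exact: mem_fam. Qed.

(** Some column of the cokernel of [W] is nonzero on [w]; it is negated if its value there is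
    positive. *)
Lemma annihilate m (W : 'M[R]_(m, N)) (w : 'rV[R]_N) :
  ~~ (w <= W)%MS -> exists2 c : 'cV[R]_N, W *m c = 0 & (w *m c) 0 0 < 0.
Proof.
rewrite submxE => nz.
have /existsP[j wj] : [exists j, (w *m cokermx W) 0 j != 0].
  apply: contraNT nz => /existsPn H; apply/eqP/rowP => j.
  by have /negPn/eqP -> := H j; rewrite mxE.
have W0 : W *m col j (cokermx W) = 0 by rewrite colE mulmxA mulmx_coker mul0mx.
have wE : (w *m col j (cokermx W)) 0 0 = (w *m cokermx W) 0 j.
  by rewrite colE mulmxA -colE mxE.
have [wn|wp|w0] := ltgtP ((w *m cokermx W) 0 j) 0.
- by exists (col j (cokermx W)) => //; rewrite wE.
- exists (- col j (cokermx W)); first by rewrite mulmxN W0 oppr0.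
  by rewrite mulmxN mxE wE oppr_lt0.
- by rewrite w0 eqxx in wj.
Qed.

Lemma fam_zero_set S c : S \subset zero_set c -> fam S *m c = 0.
Proof.
move=> /fintype.subsetP Sc; apply/row_matrixP => k; rewrite row_mul rowK row0.
case: ifP => [/Sc|]; last by rewrite mul0mx.
by rewrite inE => /eqP H; apply/matrixP => i j; rewrite !ord1 [RHS]mxE -{}H.
Qed.

Lemma notin_fam_zero S c k :
  S \subset zero_set c -> val_at c k != 0 -> ~~ (u k <= fam S)%MS.
Proof.
move=> Sc; apply: contra => /submxP[D uE].
by rewrite /val_at uE -mulmxA fam_zero_set // mulmx0 mxE.
Qed.

Lemma rank_fam_lt S T c k : T \subset S -> k \in S ->
  T \subset zero_set c -> val_at c k != 0 -> (\rank (fam T) < \rank (fam S))%N.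
Proof.
move=> TS kS Tc ck; apply: rank_ltmx; rewrite ltmxE famS //=.
apply: contra (notin_fam_zero Tc ck); exact: submx_trans (mem_fam kS).
Qed.

(* Among the functionals vanishing where g does and equal to g at k0, one moves
   away from g along a line until a new point of S becomes a zero. *)
Lemma corank1_functional S g k0 : nonneg_on S g -> k0 \in S -> 0 < val_at g k0 ->
  exists g', [/\ nonneg_on S g', 0 < val_at g' k0,
    S :&: zero_set g \subset zero_set g' &
    (\rank (fam S) <= (\rank (fam (S :&: zero_set g'))).+1)%N].
Proof.
move En : (\rank (fam S) - \rank (fam (S :&: zero_set g)))%N => n.
elim/ltn_ind: n => n IHn in g En * => gS k0S gk0.
have [le|gt] := leqP (\rank (fam S)) (\rank (fam (S :&: zero_set g))).+1.
  by exists g; split=> //; exact: finset.subsetIr.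
(* The rank of [U] exceeds that of the zeros of [g] by at most one, so some vector of [S] lies
   outside [U]. A functional killing [U] can be added to [g] without losing zeros or changing the
   value at [k0]. *)
set U := (fam (S :&: zero_set g) + u k0)%MS.
have rU : (\rank U < \rank (fam S))%N.
  apply: leq_ltn_trans (mxrank_adds_leqif _ _) _.
  apply: leq_ltn_trans gt; rewrite -[in leqRHS]addn1 leq_add2l; exact: rank_leq_row.
have [k1 k1S k1U] : exists2 k, k \in S & ~~ (u k <= U)%MS.
  apply: contrapT => H; move: rU; rewrite ltnNge => /negP[].
  apply: mxrankS; apply/fam_sub => k kS; apply: contrapT => /negP kU.
  by apply: H; exists k.
have [c Uc k1c] := annihilate k1U.
have cZ k : k \in S -> val_at g k = 0 -> val_at c k = 0.
  move=> kS gk; have /submxP[D uE] : (u k <= U)%MS.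
    by apply: submx_trans (addsmxSl _ _); apply: mem_fam; rewrite !inE kS gk eqxx.
  by rewrite /val_at uE -mulmxA Uc mulmx0 mxE.
have ck0 : val_at c k0 = 0.
  have /submxP[D uE] : (u k0 <= U)%MS by exact: addsmxSr.
  by rewrite /val_at uE -mulmxA Uc mulmx0 mxE.
pose B := [pred k | (k \in S) && (val_at c k < 0)].
have Bk1 : B k1 by rewrite /= k1S.
(* Moving from [g] along [c], a point [k] of [B] becomes a zero at step [r k]; the least such step
   keeps all values on [S] nonnegative. *)
pose r k := val_at g k / - val_at c k.
case: (arg_minP r Bk1) => k2 /andP[k2S ck2] rmin.
pose g1 := g + r k2 *: c.
have g1E k : val_at g1 k = val_at g k + r k2 * val_at c k by rewrite val_atD val_atZ.
have r0 : 0 <= r k2 by rewrite divr_ge0 ?gS // oppr_ge0 ltW.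
have g1S : nonneg_on S g1.
  move=> k kS; rewrite g1E; have [ck|ck] := ltP (val_at c k) 0; last first.
    by rewrite addr_ge0 ?gS // mulr_ge0.
  have /rmin : B k by rewrite /= kS ck.
  by rewrite [X in _ <= X]/r ler_pdivlMr ?oppr_gt0 // mulrN lerNl -subr_ge0 opprK addrC.
have g1k0 : 0 < val_at g1 k0 by rewrite g1E ck0 mulr0 addr0.
have sub : S :&: zero_set g \subset S :&: zero_set g1.
  apply/fintype.subsetP => k; rewrite !inE => /andP[kS /eqP gk].
  by rewrite kS g1E gk (cZ k) // mulr0 addr0 eqxx.
have k2z : k2 \in S :&: zero_set g1.
  by rewrite !inE k2S g1E /r invrN mulrN mulNr mulfVK ?subrr ?eqxx ?lt_eqF.
have lt : (\rank (fam (S :&: zero_set g)) < \rank (fam (S :&: zero_set g1)))%N.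
  apply: (@rank_fam_lt _ _ c k2) => //; last by rewrite lt_eqF.
  by apply/fintype.subsetP => k; rewrite !inE => /andP[kS /eqP gk]; rewrite cZ.
have [|g' [g'S g'k0 zz rk]] := IHn _ _ g1 erefl g1S k0S g1k0.
  rewrite -En; apply: ltn_sub2l => //; apply: leq_trans lt _.
  by apply: mxrankS; apply: famS; exact: finset.subsetIl.
exists g'; split=> //; exact: fintype.subset_trans sub _.
Qed.

(* Adds to c a large multiple of g. *)
Lemma extend_functional g c : (forall k, 0 <= val_at g k) ->
  nonneg_on (zero_set g) c ->
  exists G, [/\ forall k, 0 <= val_at G k,
    {in zero_set g, forall k, val_at G k = val_at c k} &
    forall k, k \notin zero_set g -> 0 < val_at G k].
Proof.
(* [t] exceeds the ratio of |c| to [g] wherever [g] is positive; where [g] vanishes the quotient is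
   0 by convention. *)
move=> g0 c0; pose t := 1 + \sum_k `|val_at c k| / val_at g k.
have GE k : val_at (c + t *: g) k = val_at c k + t * val_at g k.
  by rewrite val_atD val_atZ.
have pos k : k \notin zero_set g -> 0 < val_at (c + t *: g) k.
  rewrite inE => gk; have gp : 0 < val_at g k by rewrite lt_neqAle eq_sym gk g0.
  rewrite GE /t mulrDl mul1r (bigD1 k) //= mulrDl divfK //.
  set s := \sum_(_ | _) _; have s0 : 0 <= s by apply: sumr_ge0 => i _; rewrite divr_ge0.
  have := ler_norm (- val_at c k); rewrite normrN -subr_ge0 opprK => H.
  have H' : 0 <= s * val_at g k by rewrite mulr_ge0.
  rewrite addrCA; apply: ltr_pwDl => //; rewrite addrA; apply: addr_ge0 => //.
  by rewrite addrC.
have eqz : {in zero_set g, forall k, val_at (c + t *: g) k = val_at c k}.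
  by move=> k; rewrite inE GE => /eqP ->; rewrite mulr0 addr0.
exists (c + t *: g); split=> // k; have [kz|/pos/ltW//] := boolP (k \in zero_set g).
by rewrite eqz ?c0.
Qed.

(** * Exposed points and flags for vectors on the affine hyperplane [e0 = 1] *)

Variable e0 : 'cV[R]_N.
Hypothesis e01 : forall k, val_at e0 k = 1.

(** Vectors are compared, not indices, because a configuration may list the same point several
    times. *)
Definition exposed_index k := exists g,
  [/\ forall j, 0 <= val_at g j, val_at g k = 0 & {in zero_set g, forall j, u j = u k}].

(** Two distinct vectors of a face differ in some coordinate, and minimizing that coordinate over
    the face gives a strictly smaller face. *)
Lemma exists_exposed g k0 : (forall k, 0 <= val_at g k) -> k0 \in zero_set g ->
  exists2 k, k \in zero_set g & exposed_index k.
Proof.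
move En : #|zero_set g| => n; elim/ltn_ind: n => n IHn in g k0 En * => g0 k0z.
have [/forall_inP all_eq|] := boolP [forall k in zero_set g, u k == u k0].
  exists k0 => //; exists g; split=> // [|k /all_eq/eqP //].
  by apply/eqP; move: k0z; rewrite inE.
case/forall_inPn => k1 k1z neq.
have [i ni] : exists i, u k1 0 i != u k0 0 i.
  apply: contrapT => H; case/eqP: neq; apply/rowP => i; apply: contrapT => /eqP ne.
  by apply: H; exists i.
pose f k := u k 0 i.
have fE k : val_at (delta_mx i 0) k = f k by rewrite /val_at -colE mxE.
case: (arg_minP f k0z) => k2 k2z fmin.
(* [e0] supplies the constant that turns the minimum of the coordinate into 0. *)
pose c : 'cV[R]_N := delta_mx i 0 - f k2 *: e0.
have cE k : val_at c k = f k - f k2 by rewrite val_atD val_atN val_atZ e01 mulr1 fE.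
have [k kz|G [G0 Gz Gp]] := @extend_functional g c g0.
  by rewrite cE subr_ge0 fmin.
have sub : zero_set G \subset zero_set g.
  apply/fintype.subsetP => k; apply: contraLR => /Gp; by rewrite inE => /gt_eqF ->.
have GzE k : k \in zero_set G -> f k = f k2.
  move=> kG; have := Gz k (fintype.subsetP sub _ kG); move: kG; rewrite inE => /eqP ->.
  by rewrite cE => /esym/eqP; rewrite subr_eq0 => /eqP.
have k2G : k2 \in zero_set G by rewrite inE Gz // cE subrr.
have lt : (#|zero_set G| < n)%N.
  rewrite -En; apply: proper_card; rewrite properE sub /=; apply/subsetPn.
  have [k1G|] := boolP (k1 \in zero_set G); last by exists k1.
  exists k0 => //; apply: contra ni => k0G.
  by apply/eqP; rewrite -/(f k1) -/(f k0) !GzE.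
have [k kG ke] := IHn _ lt G k2 erefl G0 k2G.
by exists k => //; exact: (fintype.subsetP sub).
Qed.

(** An exposed point is taken in the subface where [h] is maximal; its value there is at least the
    one at [k0]. *)
Lemma exists_exposed_pos g h k0 : (forall k, 0 <= val_at g k) ->
  k0 \in zero_set g -> 0 < val_at h k0 ->
  exists k, [/\ k \in zero_set g, 0 < val_at h k & exposed_index k].
Proof.
move=> g0 k0z hk0; case: (arg_maxP (val_at h) k0z) => k1 k1z hmax.
pose c : 'cV[R]_N := val_at h k1 *: e0 - h.
have cE k : val_at c k = val_at h k1 - val_at h k.
  by rewrite val_atD val_atN val_atZ e01 mulr1.
have [k kz|G [G0 Gz Gp]] := @extend_functional g c g0.
  by rewrite cE subr_ge0; apply: hmax.
have k1G : k1 \in zero_set G by rewrite inE Gz // cE subrr.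
have [k kG ke] := exists_exposed G0 k1G.
have kz : k \in zero_set g by apply: contraLR kG => /Gp; rewrite inE => /gt_eqF ->.
exists k; split=> //; have := Gz k kz; move: kG; rewrite inE => /eqP ->.
by rewrite cE => /esym/eqP; rewrite subr_eq0 => /eqP <-; apply: lt_le_trans (hmax _ k0z).
Qed.

Definition facet_functional h :=
  (forall k, 0 <= val_at h k) /\ (\rank (fam [set: 'I_l]%SET) = (\rank (fam (zero_set h))).+1)%N.

(* Descends along a maximal flag of faces; the i-th point lies in the i-th face
   but not in the next one, which the i-th facet cuts out. *)
Lemma flag_triangle g r : (forall k, 0 <= val_at g k) ->
  \rank (fam (zero_set g)) = r ->
  exists (h : 'I_r -> 'cV[R]_N) (p : 'I_r -> 'I_l),
    [/\ forall i, facet_functional (h i),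
        forall i, p i \in zero_set g /\ exposed_index (p i),
        forall i, val_at (h i) (p i) != 0 &
        forall i j : 'I_r, (i < j)%N -> val_at (h i) (p j) = 0].
Proof.
elim: r g => [|r IHr] g g0 rg.
  have no (T : Type) : 'I_0 -> T by case.
  by exists (no _), (no _); split=> [[]|[]|[]|[]].
have [k0 k0z] : exists k, k \in zero_set g.
  apply: contrapT => H; suff: \rank (fam (zero_set g)) = 0%N by rewrite rg.
  apply/eqP; rewrite mxrank_eq0 -submx0; apply/fam_sub => k kz.
  by case: H; exists k.
have e0n : nonneg_on (zero_set g) e0 by move=> k _; rewrite e01.
(* Inside the face of [g], the functional [c] cuts out a subface of corank at most one that misses
   [k0]. [G] makes it a face of the whole configuration, and [h] is a facet that contains it and
   still misses [k0]. *)
have [|c [c0 ck0 _ rc]] := corank1_functional e0n k0z; first by rewrite e01.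
have [G [G0 Gz Gp]] := extend_functional g0 c0.
have Gk0 : 0 < val_at G k0 by rewrite Gz.
have [h [h0 hk0 Gh rh]] := @corank1_functional [set: 'I_l]%SET G k0 (fun k _ => G0 k) (finset.in_setT _) Gk0.
have {}h0 k : 0 <= val_at h k by apply: h0; rewrite finset.in_setT.
rewrite !finset.setTI in Gh rh.
have hfacet : facet_functional h.
  split=> //; apply/eqP; rewrite eqn_leq rh /=.
  apply: (@rank_fam_lt _ _ h k0); rewrite ?finset.subsetT ?finset.in_setT ?subxx //.
  by rewrite gt_eqF.
have ghE k : (k \in zero_set (g + h)) = (k \in zero_set g) && (k \in zero_set h).
  by rewrite !inE val_atD paddr_eq0.
have gh0 k : 0 <= val_at (g + h) k by rewrite val_atD addr_ge0.
(* The rank drops because [h] is nonzero at [k0], and only by one because the facet of [h] contains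
   the subface cut out by [c]. *)
have rgh : \rank (fam (zero_set (g + h))) = r.
  apply/eqP; rewrite eqn_leq; apply/andP; split.
    rewrite -ltnS -rg; apply: (@rank_fam_lt _ _ h k0) => //; last by rewrite gt_eqF.
      by apply/fintype.subsetP => k; rewrite ghE => /andP[].
    by apply/fintype.subsetP => k; rewrite ghE => /andP[].
  rewrite -ltnS -rg; apply: leq_trans rc _; rewrite ltnS; apply: mxrankS; apply: famS.
  apply/fintype.subsetP => k; rewrite inE ghE => /andP[kz kc]; rewrite kz /=.
  by apply: (fintype.subsetP Gh); rewrite inE Gz //; move: kc; rewrite inE.
have [hs [ps [hsf psz psn pst]]] := IHr _ gh0 rgh.
have [k1 [k1z hk1 k1e]] := exists_exposed_pos g0 k0z hk0.
exists (fun i => oapp hs h (unlift ord0 i)), (fun i => oapp ps k1 (unlift ord0 i)).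
split=> [i|i|i|i j].
- by case: unliftP => [j|] _ /=.
- case: unliftP => //= j _; have [H ?] := psz j; split=> //.
  by move: H; rewrite ghE => /andP[].
- by case: unliftP => //= _; rewrite gt_eqF.
- case: (unliftP ord0 i) => [i' ->|->]; case: (unliftP ord0 j) => [j' ->|->] //=.
    by rewrite /bump !leq0n !add1n ltnS; apply: pst.
  by move=> _; have [H _] := psz j'; move: H; rewrite ghE => /andP[_]; rewrite inE => /eqP.
Qed.

End VectorConfiguration.

(** * Affine spans in homogeneous coordinates *)

Section Homogenization.
Variables (R : realType) (n : nat).
Implicit Types (A G : set 'rV[R]_n) (h : 'cV[R]_n * R) (x : 'rV[R]_n) (c : 'cV[R]_(1 + n)).

Definition hom1 x : 'rV[R]_(1 + n) := row_mx 1%:M x.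
Definition hom1_fun h : 'cV[R]_(1 + n) := col_mx h.2%:M h.1.
Definition affine_fun c : 'cV[R]_n * R := (dsubmx c, c 0 0).

Lemma aff_hom1 h x : aff h x = (hom1 x *m hom1_fun h) 0 0.
Proof. by rewrite /aff mul_row_col mul1mx [RHS]mxE addrC !mxE eqxx. Qed.

Lemma affine_funK : cancel affine_fun hom1_fun.
Proof.
move=> c; rewrite /hom1_fun /= -[RHS]vsubmxK; congr col_mx.
apply/matrixP => i j; rewrite !ord1 !mxE eqxx mulr1n; congr (c _ _); exact: val_inj.
Qed.

Lemma aff_affine_fun c x : aff (affine_fun c) x = (hom1 x *m c) 0 0.
Proof. by rewrite aff_hom1 affine_funK. Qed.

Lemma hom1_inj : injective hom1.
Proof. by move=> x y /eq_row_mx[]. Qed.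

Lemma hom1_sum k (p : 'I_k -> 'rV[R]_n) (a : 'I_k -> R) : \sum_i a i = 1 ->
  hom1 (\sum_i a i *: p i) = \sum_i a i *: hom1 (p i).
Proof.
move=> a1; apply/rowP => j; rewrite -(splitK j) summxE; case: (split j) => j' /=.
  rewrite row_mxEl !ord1 mxE eqxx -[LHS]a1; apply: eq_bigr => i _.
  by rewrite mxE row_mxEl mxE eqxx mulr1.
rewrite row_mxEr summxE; apply: eq_bigr => i _.
by rewrite mxE [RHS]mxE row_mxEr.
Qed.

Lemma aff_sum h k (p : 'I_k -> 'rV[R]_n) (a : 'I_k -> R) : \sum_i a i = 1 ->
  aff h (\sum_i a i *: p i) = \sum_i a i * aff h (p i).
Proof.
move=> a1; rewrite aff_hom1 hom1_sum // mulmx_suml summxE; apply: eq_bigr => i _.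
by rewrite -scalemxAl mxE aff_hom1.
Qed.

(** The universal property of the linear span of the homogenized points, which handles an infinite
    set without choosing a basis in it. *)
Definition spans A m (U : 'M[R]_(m, 1 + n)) :=
  forall k (W : 'M[R]_(k, 1 + n)), (U <= W)%MS <-> forall x, A x -> (hom1 x <= W)%MS.

Lemma spans_sub A m (U : 'M[R]_(m, 1 + n)) x : spans A U -> A x -> (hom1 x <= U)%MS.
Proof. by move=> sU; exact: (sU _ U).1. Qed.

Lemma spans_rank A m (U : 'M[R]_(m, 1 + n)) k (V : 'M[R]_(k, 1 + n)) :
  spans A U -> spans A V -> \rank U = \rank V.
Proof.
move=> sU sV; apply/eqP; rewrite eqn_leq !mxrankS //.
  by apply/sV => x; exact: spans_sub.
by apply/sU => x; exact: spans_sub.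
Qed.

Lemma affine_rank_spans A r : affine_rank A r ->
  exists2 U : 'M[R]_(r, 1 + n), spans A U & \rank U = r.
Proof.
move=> [B [fB rB sB]]; exists B; last exact/eqP.
move=> k W; split=> [BW x /sB|AW]; first by move=> /submx_trans; apply.
by apply/row_subP => i; have [x Ax ->] := rB i; exact: AW.
Qed.

(** Affinely independent families have at most [1 + n] members, so a largest one exists, and a point
    outside its span would enlarge it. *)
Lemma ex_affine_rank A : exists r, affine_rank A r.
Proof.
pose free r := `[< exists B : 'M[R]_(r, 1 + n), row_free B /\
  forall i, exists2 x, A x & row i B = hom1 x >].
have ex0 : exists r, free r.
  exists 0%N; apply/asboolP; exists 0; split; last by case.
  by rewrite /row_free mxrank0.
have bnd r : free r -> (r <= 1 + n)%N.
  by move=> /asboolP[B [/eqP rB _]]; rewrite -{1}rB; exact: rank_leq_col.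
case: (ex_maxnP ex0 bnd) => r /asboolP[B [fB rB]] rmax.
exists r, B; split=> // x Ax; apply: contrapT => /negP xB.
suff /rmax : free r.+1 by rewrite ltnn.
rewrite -add1n; apply/asboolP; exists (col_mx (hom1 x) B); split.
  rewrite /row_free -addsmxE; apply/eqP.
  have /mxdirectP/= -> : mxdirect (hom1 x + B).
    apply/mxdirect_addsP/eqP; rewrite -submx0; apply/rV_subP => y.
    rewrite sub_capmx => /andP[/sub_rVP[a ->]] aB.
    have [->|a0] := eqVneq a 0; first by rewrite scale0r sub0mx.
    case/negP: xB; rewrite -/(hom1 x) -[hom1 x]scale1r -(mulVf a0) -scalerA.
    exact: scalemx_sub.
  rewrite (eqP fB); congr addn; rewrite rank_rV; have [x0|//] := eqVneq (hom1 x) 0.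
  by case/negP: xB; rewrite -/(hom1 x) x0 sub0mx.
move=> i; rewrite -(splitK i); case: (split i) => j /=.
  by exists x => //; rewrite rowKu ord1 row_id.
by have [y Ay yE] := rB j; exists y => //; rewrite rowKd.
Qed.

Lemma spans_affine_rank A m (U : 'M[R]_(m, 1 + n)) : spans A U -> affine_rank A (\rank U).
Proof.
move=> sU; have [r Ar] := ex_affine_rank A.
by have [V sV rV] := affine_rank_spans Ar; rewrite (spans_rank sU sV) rV.
Qed.

Lemma affine_rank_inj A r s : affine_rank A r -> affine_rank A s -> r = s.
Proof.
move=> /affine_rank_spans[U sU rU] /affine_rank_spans[V sV rV].
by rewrite -rU -rV; exact: spans_rank sU sV.
Qed.

Lemma spans_vanish A m (U : 'M[R]_(m, 1 + n)) q (c : 'M[R]_(1 + n, q)) :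
  spans A U -> (forall x, A x -> hom1 x *m c = 0) -> U *m c = 0.
Proof. by move=> sU Ac; apply/sub_kermxP/sU => x /Ac/sub_kermxP. Qed.

Lemma sub_conv G : G `<=` conv G.
Proof.
move=> x Gx; exists 1%N, (fun=> x), (fun=> 1); split=> //.
  by rewrite big_ord1.
by rewrite big_ord1 scale1r.
Qed.

Lemma valid_on_conv G h : valid_on (conv G) h <-> valid_on G h.
Proof.
split=> [vh x /sub_conv/vh//|vh x [k [p [a [Gp a0 a1 ->]]]]].
by rewrite aff_sum //; apply: sumr_ge0 => i _; rewrite mulr_ge0 ?vh.
Qed.

(** A sum of nonnegative terms vanishes only if each term does, so every point of nonzero weight is
    itself a zero. *)
Lemma zeros_in_conv G h x : valid_on G h -> zeros_in (conv G) h x ->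
  exists k (p : 'I_k -> 'rV[R]_n) (a : 'I_k -> R),
  [/\ forall i, 0 <= a i, \sum_i a i = 1, x = \sum_i a i *: p i &
      forall i, a i != 0 -> zeros_in G h (p i)].
Proof.
move=> vh [[k [p [a [Gp a0 a1 xE]]]] hx]; exists k, p, a; split=> // i ai.
split=> //; move: hx; rewrite xE aff_sum // => /eqP.
rewrite psumr_eq0 => [/allP/(_ i (mem_index_enum _))|j _]; last by rewrite mulr_ge0 ?vh.
by rewrite /= mulf_eq0 (negPf ai) => /eqP.
Qed.

Lemma conv_zeros_hom1 G h x k (W : 'M[R]_(k, 1 + n)) : valid_on G h ->
  zeros_in (conv G) h x -> (forall y, zeros_in G h y -> (hom1 y <= W)%MS) ->
  (hom1 x <= W)%MS.
Proof.
move=> vh /(zeros_in_conv vh)[l [p [a [a0 a1 -> az]]]] GW.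
rewrite hom1_sum //; apply: summx_sub => i _.
have [->|/az/GW] := eqVneq (a i) 0; first by rewrite scale0r sub0mx.
exact: scalemx_sub.
Qed.

Lemma spans_zeros_conv G h m (U : 'M[R]_(m, 1 + n)) : valid_on G h ->
  spans (zeros_in G h) U -> spans (zeros_in (conv G) h) U.
Proof.
move=> vh sU k W; split=> [UW x xz|H].
  apply: (conv_zeros_hom1 vh xz) => y yz; apply: submx_trans UW; exact: spans_sub yz.
by apply/sU => y [Gy hy]; apply: H; split=> //; exact: sub_conv.
Qed.

Lemma zeros_conv_sub G h h' : valid_on G h ->
  zeros_in G h `<=` zeros_in G h' -> zeros_in (conv G) h `<=` zeros_in (conv G) h'.
Proof.
move=> vh sub x xz; split; first by case: xz.
have [k [p [a [a0 a1 -> az]]]] := zeros_in_conv vh xz.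
rewrite aff_sum // big1 // => i _; have [->|/az/sub[_ ->]] := eqVneq (a i) 0.
  by rewrite mul0r.
by rewrite mulr0.
Qed.

Lemma zeros_conv_eq G h h' : valid_on G h -> valid_on G h' ->
  (forall x, G x -> aff h x = 0 <-> aff h' x = 0) ->
  zeros_in (conv G) h = zeros_in (conv G) h'.
Proof.
move=> vh vh' E; apply/seteqP; split; apply: zeros_conv_sub => // x [Gx hx]; split=> //; exact/E.
Qed.

Lemma zeros_conv_set1 G h v : valid_on G h -> G v -> aff h v = 0 ->
  (forall x, zeros_in G h x -> x = v) -> zeros_in (conv G) h = [set v].
Proof.
move=> vh Gv hv uniq; apply/seteqP; split=> [x xz|x ->]; last first.
  by split=> //; exact: sub_conv.
have [k [p [a [a0 a1 -> az]]]] := zeros_in_conv vh xz.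
rewrite (eq_bigr (fun i => a i *: v)); first by rewrite -scaler_suml a1 scale1r.
by move=> i _; have [->|/az/uniq ->//] := eqVneq (a i) 0; rewrite !scale0r.
Qed.

(** A generator of nonzero weight in a combination equal to [v] lies on the face cut out by [h],
    which is the single point [v]. *)
Lemma vertex_conv G v : is_vertex (conv G) v -> G v.
Proof.
move=> [h /valid_on_conv vh E]; have vz : zeros_in (conv G) h v by rewrite -E.
have [k [p [a [a0 a1 vE az]]]] := zeros_in_conv vh vz.
have [i ai] : exists i, a i != 0.
  apply: contrapT => H; move: a1; rewrite big1 => [/esym/eqP|i _]; first by rewrite oner_eq0.
  by apply/eqP; apply: contrapT => /negP ai; apply: H; exists i.
have [Gp hp] := az _ ai; suff -> : v = p i by [].
have : zeros_in (conv G) h (p i) by split=> //; exact: sub_conv.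
by rewrite -E => ->.
Qed.

Lemma spans_full A m (U : 'M[R]_(m, 1 + n)) c : spans A U -> \rank U = n.+1 ->
  (forall x, A x -> (hom1 x *m c) 0 0 = 0) -> c = 0.
Proof.
move=> sU rU Ac; have Uc : U *m c = 0.
  by apply: (spans_vanish sU) => x /Ac xc; apply/matrixP => i j; rewrite !ord1 xc mxE.
have /row_fullP[V VU] : row_full U by rewrite /row_full rU.
by rewrite -[c]mul1mx -VU -mulmxA Uc mulmx0.
Qed.

Lemma zeros_in0 A : zeros_in A 0 = A.
Proof.
apply/seteqP; split=> [x []//|x Ax]; split=> //.
by rewrite /aff /= mulmx0 mxE addr0.
Qed.

End Homogenization.

(** * Vanishing minors and triangular minors of a slack matrix *)

(** A slack matrix is a product of facet functionals and points in homogeneous coordinates, so it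
    factors through dimension [n + 1]. *)
Lemma slack_minor0 (R : realType) n (P : set 'rV[R]_n) m k (S : 'M[R]_(m, k))
    r (rs : 'I_r -> 'I_m) (cs : 'I_r -> 'I_k) :
  is_slack_matrix P S -> (n.+1 < r)%N -> \det (mxsub rs cs S) = 0.
Proof.
move=> [h [v [_ _ ->]]] nr.
pose V := \matrix_(j < r) hom1 (v (cs j)).
pose H := \matrix_(i < r) (hom1_fun (h (rs i)))^T.
have -> : mxsub rs cs (\matrix_(i, j) aff (h i) (v j)) = H *m V^T.
  apply/matrixP => i j; rewrite !mxE aff_hom1 mxE; apply: eq_bigr => l _.
  by rewrite /H /V !mxE mulrC.
apply/eqP; apply: contraTT nr; rewrite -leqNgt -unitfE -unitmxE => /mxrank_unit <-.
exact: leq_trans (mxrankM_maxl _ _) (rank_leq_col _).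
Qed.

(** The flag starts from the zero functional, whose face is [P] itself, of rank [n + 1]. The
    functionals found may differ from those defining [S], but they cut out the same facets, and only
    the vanishing of entries is compared. *)
Lemma slack_triangle (R : realType) n (P : set 'rV[R]_n) m k (S : 'M[R]_(m, k)) :
  is_polytope P -> full_dimensional P -> is_slack_matrix P S ->
  exists (rs : 'I_n.+1 -> 'I_m) (cs : 'I_n.+1 -> 'I_k),
    (forall i, S (rs i) (cs i) != 0) /\
    (forall i j : 'I_n.+1, (i < j)%N -> S (rs i) (cs j) = 0).
Proof.
move=> [s PE] fullP [h [v [[vh hF _] [vv _] SE]]].
pose u (l : 'I_(size s)) := hom1 (tnth (in_tuple s) l).
have uP l : [set` s] (tnth (in_tuple s) l) by rewrite /= mem_tnth.
have valE c l : val_at u c l = aff (affine_fun c) (tnth (in_tuple s) l).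
  by rewrite /val_at aff_affine_fun.
have valid c : (forall l, 0 <= val_at u c l) -> valid_on [set` s] (affine_fun c).
  by move=> c0 x /= /(tnthP (in_tuple s))[l ->]; rewrite -valE.
have spz c : (forall l, 0 <= val_at u c l) ->
    spans (zeros_in P (affine_fun c)) (fam u (zero_set u c)).
  move=> c0; rewrite PE; apply: (spans_zeros_conv (valid _ c0)).
  move=> q W; split=> [/fam_sub H x [/(tnthP (in_tuple s))[l ->]]|H].
    by rewrite -valE => cl; apply: H; rewrite inE cl.
  by apply/fam_sub => l; rewrite inE valE => /eqP cl; apply: H.
have z0 : zero_set u 0 = [set: 'I_(size s)]%SET.
  by apply/setP => l; rewrite !inE /val_at mulmx0 mxE eqxx.
have aff0 : affine_fun 0 = 0 :> 'cV[R]_n * R.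
  by rewrite /affine_fun mxE; congr (_, _); apply/matrixP => i j; rewrite !mxE.
have val0 l : 0 <= val_at u 0 l by rewrite /val_at mulmx0 mxE.
have rT : \rank (fam u [set: 'I_(size s)]%SET) = n.+1.
  have := spz 0 val0; rewrite z0 aff0 zeros_in0 => /spans_affine_rank Pr.
  exact: affine_rank_inj Pr fullP.
(* The first homogeneous coordinate plays the role of [e0]. *)
have e01 l : val_at u (delta_mx 0 0) l = 1.
  have E : 0 = lshift n 0 :> 'I_(1 + n) by exact: val_inj.
  by rewrite /val_at -colE [LHS]mxE /u /hom1 E row_mxEl mxE.
have [|hs [ps [hf psz psn pst]]] := @flag_triangle R _ _ u _ e01 0 n.+1 val0.
  by rewrite z0 rT.
have facet i : exists i', zeros_in P (affine_fun (hs i)) = zeros_in P (h i').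
  apply/hF; have [h0 hr] := hf i; split.
    by exists (affine_fun (hs i)) => //; rewrite PE; apply/valid_on_conv/valid.
  exists n; split=> //; have /spans_affine_rank := spz _ h0.
  by move: hr; rewrite rT => -[<-].
have vertex i : exists j, tnth (in_tuple s) (ps i) = v j.
  apply/vv; have [_ [g [g0 gp gu]]] := psz i.
  exists (affine_fun g); first by rewrite PE; apply/valid_on_conv/valid.
  rewrite PE; apply/esym/zeros_conv_set1 => //; first exact: valid.
    by rewrite -valE.
  move=> x [/(tnthP (in_tuple s))[l ->]]; rewrite -valE => gl.
  by apply: hom1_inj; apply: gu; rewrite inE gl.
have [rs rsE] := boolp.choice facet; have [cs csE] := boolp.choice vertex.
have SE0 i j : S (rs i) (cs j) = 0 <-> val_at u (hs i) (ps j) = 0.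
  have Pv : P (v (cs j)) by rewrite -csE PE; apply: sub_conv.
  rewrite SE mxE valE csE; split=> H.
    have : zeros_in P (h (rs i)) (v (cs j)) by split.
    by rewrite -rsE => -[].
  have : zeros_in P (affine_fun (hs i)) (v (cs j)) by split.
  by rewrite rsE => -[].
exists rs, cs; split=> [i|i j ij]; last exact/SE0/pst.
by apply/eqP => /SE0/eqP; apply/negP.
Qed.

(** * Facets and vertices of a join *)

(* f and g are affine maps, given in homogeneous coordinates by A and B. *)
Definition join_maps (R : realType) (d e D : nat)
    (P : set 'rV[R]_d) (Q : set 'rV[R]_e) (J : set 'rV[R]_D)
    (f : 'rV[R]_d -> 'rV[R]_D) (g : 'rV[R]_e -> 'rV[R]_D)
    (A : 'M[R]_(1 + d, 1 + D)) (B : 'M[R]_(1 + e, 1 + D)) :=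
  [/\ forall x, hom1 (f x) = hom1 x *m A, forall y, hom1 (g y) = hom1 y *m B,
      row_free (col_mx A B) & J = conv (f @` P `|` g @` Q)].

(** In a linear relation between the stacked rows the first coordinates give [t = - s]. If [s] is
    nonzero, dividing by it yields a common point of the two affine spans; if it is zero, the
    relation is a common vector of the direction spaces. *)
Lemma is_join_maps (R : realType) (d e : nat)
    (P : set 'rV[R]_d) (Q : set 'rV[R]_e) (J : set 'rV[R]_(d + e + 1)) :
  is_join P Q J -> exists f g A B, @join_maps R d e _ P Q J f g A B.
Proof.
move=> [A [a [B [b [[fA fB] disj AB JE]]]]].
exists (fun x => x *m A + a), (fun y => y *m B + b),
  (block_mx 1%:M a 0 A), (block_mx 1%:M b 0 B); split=> //.
- by move=> x; rewrite /hom1 mul_row_block !mul1mx mulmx0 addr0 addrC.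
- by move=> y; rewrite /hom1 mul_row_block !mul1mx mulmx0 addr0 addrC.
rewrite -kermx_eq0 -submx0; apply/rV_subP => w /sub_kermxP.
rewrite -[w]hsubmxK mul_row_col -[lsubmx w]hsubmxK -[rsubmx w]hsubmxK !mul_row_block.
set s := lsubmx (lsubmx w); set x := rsubmx _; set t := lsubmx (rsubmx w); set y := rsubmx _.
rewrite !mulmx1 !mulmx0 !addr0 add_row_mx -[0]row_mx0 => /eq_row_mx[st0 E].
have tE : t = - s by apply/eqP; rewrite -addr_eq0 addrC st0.
have [z sE] : exists z, s = z%:M by exists (s 0 0); exact: mx11_scalar.
have [s0|s0] := eqVneq z 0; last first.
  case: (disj (z^-1 *: x) (- z^-1 *: y)); apply: (scalerI s0).
  rewrite !scalerDr -!scalemxAl !scalerA mulrN mulfV // scaleN1r scale1r.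
  move: E; rewrite tE sE mulNmx !mul_scalar_mx => E.
  apply/eqP; rewrite -subr_eq0 -E opprD opprK addrACA; apply/eqP.
  by rewrite [RHS]addrACA [LHS]addrC.
have sz : s = 0 by rewrite sE s0; apply/matrixP => i j; rewrite !mxE mul0rn.
move: E; rewrite tE sz oppr0 !mul0mx !add0r => E.
have xA : (x *m A <= A :&: B)%MS.
  rewrite sub_capmx submxMl /=; have -> : x *m A = - y *m B.
    by apply/eqP; rewrite mulNmx -addr_eq0 E.
  exact: submxMl.
have x0 : x = 0 by apply: (row_free_inj fA); rewrite mul0mx; apply/eqP; rewrite -submx0 -AB.
have y0 : y = 0 by apply: (row_free_inj fB); rewrite mul0mx -E x0 mul0mx add0r.
by rewrite x0 y0 !row_mx0 sub0mx.
Qed.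

Lemma join_maps_sym (R : realType) (d e D : nat)
    (P : set 'rV[R]_d) (Q : set 'rV[R]_e) (J : set 'rV[R]_D) f g A B :
  join_maps P Q J f g A B -> join_maps Q P J g f B A.
Proof.
move=> [Hf Hg fAB ->]; split=> //; last by rewrite setUC.
by rewrite /row_free -addsmxE addsmxC addsmxE (eqP fAB) addnC.
Qed.

Section Join.
Variables (R : realType) (d e D : nat).
Variables (P : set 'rV[R]_d) (Q : set 'rV[R]_e) (J : set 'rV[R]_D).
Variables (f : 'rV[R]_d -> 'rV[R]_D) (g : 'rV[R]_e -> 'rV[R]_D).
Variables (A : 'M[R]_(1 + d, 1 + D)) (B : 'M[R]_(1 + e, 1 + D)).
Hypothesis PQJ : join_maps P Q J f g A B.

Let hom_f x : hom1 (f x) = hom1 x *m A. Proof. by case: PQJ. Qed.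
Let hom_g y : hom1 (g y) = hom1 y *m B. Proof. by case: PQJ. Qed.
Let freeAB : row_free (col_mx A B). Proof. by case: PQJ. Qed.
Let JE : J = conv (f @` P `|` g @` Q). Proof. by case: PQJ. Qed.

Lemma join_left x : P x -> J (f x).
Proof. by move=> Px; rewrite JE; apply: sub_conv; left; exists x. Qed.

Lemma join_right y : Q y -> J (g y).
Proof. by move=> Qy; rewrite JE; apply: sub_conv; right; exists y. Qed.

Lemma join_left_inj : injective f.
Proof.
move=> x x' E; apply: hom1_inj; have := row_free_inj freeAB.
move=> /(_ _ (row_mx (hom1 x) 0) (row_mx (hom1 x') 0)).
rewrite !mul_row_col !mul0mx !addr0 -!hom_f E => /(_ erefl).
by move=> /eq_row_mx[].
Qed.

Lemma join_left_right x y : f x <> g y.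
Proof.
move=> E; have := row_free_inj freeAB.
move=> /(_ _ (row_mx (hom1 x) 0) (row_mx 0 (hom1 y))).
rewrite !mul_row_col !mul0mx !addr0 add0r -hom_f -hom_g E => /(_ erefl).
move=> /eq_row_mx[/eqP]; rewrite /hom1 -row_mx0 => /eqP/eq_row_mx[/matrixP/(_ 0 0)].
by rewrite !mxE eqxx => /eqP; rewrite oner_eq0.
Qed.

Definition pull n (C : 'M[R]_(1 + n, 1 + D)) h := affine_fun (C *m hom1_fun h).

Lemma aff_pull_left h x : aff (pull A h) x = aff h (f x).
Proof. by rewrite aff_affine_fun mulmxA -hom_f -aff_hom1. Qed.

Lemma aff_pull_right h y : aff (pull B h) y = aff h (g y).
Proof. by rewrite aff_affine_fun mulmxA -hom_g -aff_hom1. Qed.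

Lemma valid_on_join h : valid_on J h <-> valid_on P (pull A h) /\ valid_on Q (pull B h).
Proof.
split=> [vh|[vP vQ]].
  by split=> [x /join_left/vh|y /join_right/vh]; rewrite ?aff_pull_left ?aff_pull_right.
rewrite JE; apply/valid_on_conv => _ [[x Px <-]|[y Qy <-]].
  by rewrite -aff_pull_left; apply: vP.
by rewrite -aff_pull_right; apply: vQ.
Qed.

Lemma zeros_in_join_eq h h' : valid_on J h -> valid_on J h' ->
  zeros_in P (pull A h) = zeros_in P (pull A h') ->
  zeros_in Q (pull B h) = zeros_in Q (pull B h') -> zeros_in J h = zeros_in J h'.
Proof.
rewrite JE => /valid_on_conv vh /valid_on_conv vh' EP EQ.
apply: zeros_conv_eq => // _ [[x Px <-]|[y Qy <-]]; split=> H.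
- have : zeros_in P (pull A h) x by split=> //; rewrite aff_pull_left.
  by rewrite EP => -[_]; rewrite aff_pull_left.
- have : zeros_in P (pull A h') x by split=> //; rewrite aff_pull_left.
  by rewrite -EP => -[_]; rewrite aff_pull_left.
- have : zeros_in Q (pull B h) y by split=> //; rewrite aff_pull_right.
  by rewrite EQ => -[_]; rewrite aff_pull_right.
- have : zeros_in Q (pull B h') y by split=> //; rewrite aff_pull_right.
  by rewrite -EQ => -[_]; rewrite aff_pull_right.
Qed.

(** The stacked matrix has a right inverse, so an affine function can be prescribed independently on
    the two spans. *)
Lemma join_functional (hP : 'cV[R]_d * R) (hQ : 'cV[R]_e * R) : exists h,
  (forall x, aff h (f x) = aff hP x) /\ (forall y, aff h (g y) = aff hQ y).
Proof.
pose c := pinvmx (col_mx A B) *m col_mx (hom1_fun hP) (hom1_fun hQ).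
have := mulmxVp freeAB; move=> /(congr1 (mulmx^~ (col_mx (hom1_fun hP) (hom1_fun hQ)))).
rewrite -mulmxA -/c mul1mx mul_col_mx => /eq_col_mx[EA EB].
exists (affine_fun c); split=> [x|y].
  by rewrite aff_affine_fun hom_f -mulmxA EA -aff_hom1.
by rewrite aff_affine_fun hom_g -mulmxA EB -aff_hom1.
Qed.

(** A face of the join is spanned by its traces on the two factors. Since the stacked matrix is row
    free, the rank is that of the block diagonal matrix of [U] and [V]. *)
Lemma affine_rank_zeros_join h r s : valid_on J h ->
  affine_rank (zeros_in P (pull A h)) r -> affine_rank (zeros_in Q (pull B h)) s ->
  affine_rank (zeros_in J h) (r + s).
Proof.
move=> vh /affine_rank_spans[U sU rU] /affine_rank_spans[V sV rV].
have <- : \rank (col_mx (U *m A) (V *m B)) = (r + s)%N.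
  have /= := rank_diag_block_mx U V; rewrite rU rV -(mxrankMfree _ freeAB).
  by rewrite mul_block_col !mul0mx addr0 add0r.
apply: spans_affine_rank; rewrite JE; apply: spans_zeros_conv.
  by apply/valid_on_conv; rewrite -JE.
move=> k W; rewrite -addsmxE addsmx_sub; split=> [/andP[UW VW] _ [[[x Px <-]|[y Qy <-]]]|H].
- rewrite -aff_pull_left => hx; rewrite hom_f; apply: submx_trans UW; apply: submxMr.
  exact: spans_sub sU _.
- rewrite -aff_pull_right => hy; rewrite hom_g; apply: submx_trans VW; apply: submxMr.
  exact: spans_sub sV _.
apply/andP; split; rewrite submxE -mulmxA; apply/eqP.
  apply: (spans_vanish sU) => x [Px]; rewrite aff_pull_left => hx.
  rewrite mulmxA -hom_f; apply/eqP; rewrite -submxE; apply: H; split=> //.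
  by left; exists x.
apply: (spans_vanish sV) => y [Qy]; rewrite aff_pull_right => hy.
rewrite mulmxA -hom_g; apply/eqP; rewrite -submxE; apply: H; split=> //.
by right; exists y.
Qed.

Lemma full_join : full_dimensional P -> full_dimensional Q -> affine_rank J (d.+1 + e.+1).
Proof.
move=> fP fQ; have pull0 n (C : 'M[R]_(1 + n, 1 + D)) : pull C 0 = 0.
  rewrite /pull /hom1_fun /= raddf0 col_mx0 mulmx0 /affine_fun mxE.
  by congr (_, _); apply/matrixP => i j; rewrite !mxE.
rewrite -[J]zeros_in0; apply: affine_rank_zeros_join.
- by move=> x _; rewrite /aff /= mulmx0 mxE addr0.
- by rewrite pull0 zeros_in0.
- by rewrite pull0 zeros_in0.
Qed.

Lemma vertex_join_left v : is_vertex P v <-> is_vertex J (f v).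
Proof.
split=> [[h vh E]|[h vh E]]; last first.
  have /valid_on_join[vP _] := vh; exists (pull A h) => //; apply/seteqP; split=> x.
    move=> ->; have : [set f v] (f v) by []; rewrite E => -[Jv hv]; split; last first.
      by rewrite aff_pull_left.
    have : is_vertex J (f v) by exists h.
    rewrite JE => /vertex_conv[[y Py /join_left_inj <-//]|[y _ /esym/join_left_right[]]].
  move=> [Px]; rewrite aff_pull_left => hx; apply: join_left_inj.
  have : zeros_in J h (f x) by split=> //; exact: join_left.
  by rewrite -E.
(* Extension by the constant 1 keeps all of [Q] off the face. *)
have [H [HP HQ]] := join_functional h (0, 1).
have one y : aff (0, 1) y = 1 :> R by rewrite /aff /= mulmx0 mxE add0r.
have : [set v] v by []; rewrite E => -[Pv hv].
have vH : valid_on (f @` P `|` g @` Q) H.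
  by move=> _ [[x Px <-]|[y Qy <-]]; rewrite ?HP ?HQ ?one ?ler01 //; apply: vh.
exists H; first by rewrite JE; apply/valid_on_conv.
rewrite JE; apply/esym/zeros_conv_set1 => //; first by left; exists v.
  by rewrite HP.
move=> _ [[[x Px <-]|[y Qy <-]]]; rewrite ?HP ?HQ => hx.
  by have : zeros_in P h x by []; rewrite -E => ->.
by move/eqP: hx; rewrite one oner_eq0.
Qed.

(** Extending [h] by 0 puts all of [Q] on the face; ranks add, so corank one in [P] becomes corank
    one in [J]. *)
Lemma facet_join_left h : full_dimensional P -> full_dimensional Q ->
  valid_on P h -> is_facet P (zeros_in P h) ->
  exists H, [/\ valid_on J H, is_facet J (zeros_in J H),
    zeros_in P (pull A H) = zeros_in P h & zeros_in Q (pull B H) = Q].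
Proof.
move=> fP fQ vh [_ [r [Pr hr]]].
have [H [HP HQ]] := join_functional h 0.
have aff0 y : aff 0 y = 0 :> R by rewrite /aff /= mulmx0 mxE add0r.
have zP : zeros_in P (pull A H) = zeros_in P h.
  by apply/seteqP; split=> x [Px hx]; split=> //; move: hx; rewrite aff_pull_left HP.
have zQ : zeros_in Q (pull B H) = Q.
  apply/seteqP; split=> [y []//|y Qy]; split=> //.
  by rewrite aff_pull_right HQ aff0.
have vH : valid_on J H.
  apply/valid_on_join; split=> [x Px|y Qy].
    by rewrite aff_pull_left HP; apply: vh.
  by rewrite aff_pull_right HQ aff0.
exists H; split=> //; split; first by exists H.
exists (r + e.+1)%N; split; first by rewrite -addSn -(affine_rank_inj fP Pr); apply: full_join.
by apply: affine_rank_zeros_join => //; rewrite ?zP ?zQ.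
Qed.

(** The traces have ranks at most [d + 1] and [e + 1] with sum [d + e + 1], so exactly one is full
    and the other falls short by one. On a full trace the functional vanishes identically. *)
Lemma facet_join_cases h : full_dimensional P -> full_dimensional Q ->
  valid_on J h -> is_facet J (zeros_in J h) ->
  (is_facet P (zeros_in P (pull A h)) /\ zeros_in Q (pull B h) = Q) \/
  (is_facet Q (zeros_in Q (pull B h)) /\ zeros_in P (pull A h) = P).
Proof.
move=> fP fQ vh [_ [r [Jr hr]]]; have /valid_on_join[vP vQ] := vh.
have full n (C : 'M[R]_(1 + n, 1 + D)) (X : set 'rV[R]_n) :
    affine_rank (zeros_in X (pull C h)) n.+1 -> zeros_in X (pull C h) = X.
  move=> /affine_rank_spans[U sU rU]; apply/seteqP; split=> [x []//|x Xx]; split=> //.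
  rewrite aff_affine_fun (spans_full sU rU (c := C *m hom1_fun h)) ?mulmx0 ?mxE //.
  by move=> y [_]; rewrite aff_affine_fun.
have bound n (X : set 'rV[R]_n) s : affine_rank X s -> (s <= n.+1)%N.
  by move=> /affine_rank_spans[U _ <-]; exact: rank_leq_col.
have [s hs] := ex_affine_rank (zeros_in P (pull A h)).
have [t ht] := ex_affine_rank (zeros_in Q (pull B h)).
have rE := affine_rank_inj hr (affine_rank_zeros_join vh hs ht).
have rD := affine_rank_inj Jr (full_join fP fQ).
have := bound _ _ _ hs; have := bound _ _ _ ht; rewrite leq_eqVlt => /orP[/eqP te _|te].
  left; rewrite te in ht; split; last exact: full ht.
  split; first by exists (pull A h).
  by exists d; split=> //; have sd : s = d; [lia|rewrite sd in hs].
rewrite leq_eqVlt => /orP[/eqP sd|sd]; last lia.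
right; rewrite sd in hs; split; last exact: full hs.
split; first by exists (pull B h).
by exists e; split=> //; have te' : t = e; [lia|rewrite te' in ht].
Qed.
End Join.

(** * The support of the slack matrix of a join *)

Lemma inj_surj_bijective (T U : Type) (f : T -> U) :
  injective f -> (forall y, exists x, f x = y) -> bijective f.
Proof.
move=> finj /boolp.choice[g gK]; exists g => [x|]; last exact: gK.
by apply: finj; rewrite gK.
Qed.

Definition block_support (R : realType) mP nP mQ nQ
    (SP : 'M[R]_(mP, nP)) (SQ : 'M[R]_(mQ, nQ)) i j :=
  match i, j with
  | inl i, inl j => SP i j != 0
  | inr i, inr j => SQ i j != 0
  | _, _ => false
  end.

Lemma facet_neq (R : realType) n (P : set 'rV[R]_n) h :
  is_facet P (zeros_in P h) -> zeros_in P h <> P.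
Proof.
move=> [_ [r [Pr hr]]] E; rewrite E in hr.
by have /eqP := affine_rank_inj Pr hr; rewrite eqn_leq ltnn.
Qed.

(** Facets are matched through their traces on both factors and vertices through the embeddings.
    Only supports can be compared, because the functionals defining a slack matrix are not
    unique. *)
Lemma join_support (R : realType) (d e : nat)
  (P : set 'rV[R]_d) (Q : set 'rV[R]_e) (J : set 'rV[R]_(d + e + 1))
  (mP nP mQ nQ mJ nJ : nat)
  (SP : 'M[R]_(mP, nP)) (SQ : 'M[R]_(mQ, nQ)) (SJ : 'M[R]_(mJ, nJ)) :
  full_dimensional P -> full_dimensional Q -> is_join P Q J ->
  is_slack_matrix P SP -> is_slack_matrix Q SQ -> is_slack_matrix J SJ ->
  exists (s : 'I_mP + 'I_mQ -> 'I_mJ) (t : 'I_nP + 'I_nQ -> 'I_nJ),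
  [/\ bijective s, bijective t &
      forall i j, (SJ (s i) (t j) != 0) = block_support SP SQ i j].
Proof.
move=> fP fQ /is_join_maps[f [g [A [B PQJ]]]].
have QPJ := join_maps_sym PQJ.
move=> [hP [vP [[vhP hFP hIP] [vvP vIP] SPE]]].
move=> [hQ [vQ [[vhQ hFQ hIQ] [vvQ vIQ] SQE]]].
move=> [hJ [vJ [[vhJ hFJ hIJ] [vvJ vIJ] SJE]]].
have facP i : is_facet P (zeros_in P (hP i)) by apply/hFP; exists i.
have facQ i : is_facet Q (zeros_in Q (hQ i)) by apply/hFQ; exists i.
have facJ i : is_facet J (zeros_in J (hJ i)) by apply/hFJ; exists i.
(* [zP i] and [zQ i] are the traces on [P] and [Q] that the facet of [J] matched with [i] must
   have. *)
pose zP (i : 'I_mP + 'I_mQ) := if i is inl i then zeros_in P (hP i) else P.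
pose zQ (i : 'I_mP + 'I_mQ) := if i is inr i then zeros_in Q (hQ i) else Q.
have pulled H i : valid_on J H -> zeros_in J H = zeros_in J (hJ i) ->
    zeros_in P (pull A (hJ i)) = zeros_in P (pull A H) /\
    zeros_in Q (pull B (hJ i)) = zeros_in Q (pull B H).
  move=> vH E; split; apply/seteqP; split=> x [Xx];
    rewrite ?(aff_pull_left PQJ) ?(aff_pull_right PQJ) => hx; split=> //;
    rewrite ?(aff_pull_left PQJ) ?(aff_pull_right PQJ).
  - have : zeros_in J (hJ i) (f x) by split=> //; exact: (join_left PQJ).
    by rewrite -E => -[].
  - have : zeros_in J H (f x) by split=> //; exact: (join_left PQJ).
    by rewrite E => -[].
  - have : zeros_in J (hJ i) (g x) by split=> //; exact: (join_right PQJ).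
    by rewrite -E => -[].
  - have : zeros_in J H (g x) by split=> //; exact: (join_right PQJ).
    by rewrite E => -[].
have /boolp.choice[s sE] i : exists i',
    zeros_in P (pull A (hJ i')) = zP i /\ zeros_in Q (pull B (hJ i')) = zQ i.
  case: i => i.
    have [H [vH /hFJ[i' E] EP EQ]] := facet_join_left PQJ fP fQ (vhP i) (facP i).
    by exists i'; have [-> ->] := pulled H i' vH E.
  have [H [vH /hFJ[i' E] EQ EP]] := facet_join_left QPJ fQ fP (vhQ i) (facQ i).
  by exists i'; have [-> ->] := pulled H i' vH E.
pose w (j : 'I_nP + 'I_nQ) := match j with inl j => f (vP j) | inr j => g (vQ j) end.
have /boolp.choice[t tE] j : exists j', w j = vJ j'.
  apply/vvJ; case: j => j /=.
    by apply/(vertex_join_left PQJ)/vvP; exists j.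
  by apply/(vertex_join_left QPJ)/vvQ; exists j.
have PvP j : P (vP j).
  have [h _ E] : is_vertex P (vP j) by apply/vvP; exists j.
  by have : [set vP j] (vP j) by []; rewrite E => -[].
have QvQ j : Q (vQ j).
  have [h _ E] : is_vertex Q (vQ j) by apply/vvQ; exists j.
  by have : [set vQ j] (vQ j) by []; rewrite E => -[].
exists s, t; split.
- apply: inj_surj_bijective => [i i' E|i'].
    have [EP EQ] := sE i; have [EP' EQ'] := sE i'.
    rewrite E EP' in EP; rewrite E EQ' in EQ.
    case: i i' EP EQ {E EP' EQ'} => i [i'|i'] /=.
    + by move=> /hIP ->.
    + by move=> /esym/(facet_neq (facP i)).
    + by move=> /(facet_neq (facP i')).
    + by move=> _ /hIQ ->.
  have same i : zeros_in P (pull A (hJ i')) = zP i ->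
      zeros_in Q (pull B (hJ i')) = zQ i -> s i = i'.
    move=> EP EQ; have [EP' EQ'] := sE i; apply: hIJ.
    by apply: (zeros_in_join_eq PQJ); rewrite ?EP ?EQ.
  have [[/hFP[i EP] EQ]|[/hFQ[i EQ] EP]] := facet_join_cases PQJ fP fQ (vhJ i') (facJ i').
    by exists (inl i); apply: same.
  by exists (inr i); apply: same.
- apply: inj_surj_bijective => [j j' E|j'].
    have : w j = w j' by rewrite !tE E.
    case: j j' {E} => j [j'|j'] /=.
    + by move=> /(join_left_inj PQJ)/vIP ->.
    + by move=> /(join_left_right PQJ).
    + by move=> /esym/(join_left_right PQJ).
    + by move=> /(join_left_inj QPJ)/vIQ ->.
  have : is_vertex J (vJ j') by apply/vvJ; exists j'.
  move=> vj; have : (f @` P `|` g @` Q) (vJ j').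
    by apply: vertex_conv; have [_ _ _ <-] := PQJ.
  case=> [[x _ xE]|[y _ yE]].
    move: vj; rewrite -xE => /(vertex_join_left PQJ)/vvP[j jE].
    by exists (inl j); apply: vIJ; rewrite -tE /= -jE.
  move: vj; rewrite -yE => /(vertex_join_left QPJ)/vvQ[j jE].
  by exists (inr j); apply: vIJ; rewrite -tE /= -jE.
have Pzero h x : P x -> (aff h (f x) == 0) = `[< zeros_in P (pull A h) x >].
  move=> Px; apply/eqP/asboolP => [hx|[_]]; last by rewrite (aff_pull_left PQJ).
  by split=> //; rewrite (aff_pull_left PQJ).
have Qzero h x : Q x -> (aff h (g x) == 0) = `[< zeros_in Q (pull B h) x >].
  move=> Qx; apply/eqP/asboolP => [hx|[_]]; last by rewrite (aff_pull_right PQJ).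
  by split=> //; rewrite (aff_pull_right PQJ).
have zeroE n (X : set 'rV[R]_n) h x : X x -> `[< zeros_in X h x >] = (aff h x == 0).
  by move=> Xx; apply/asboolP/eqP => [[]|].
move=> i j; rewrite SJE mxE -tE; have [EP EQ] := sE i.
case: j => j /=; rewrite ?Pzero ?Qzero // ?EP ?EQ; case: i {EP EQ} => i /=.
- by rewrite zeroE // SPE mxE.
- by apply/negbTE; rewrite negbK; apply/asboolP.
- by apply/negbTE; rewrite negbK; apply/asboolP.
- by rewrite zeroE // SQE mxE.
Qed.

(** * Ideals and minors *)

Section Ideal.
Variable A : comPzRingType.
Implicit Types (I G : set A).

Definition is_ideal I :=
  [/\ I 0, forall a b, I a -> I b -> I (a + b) & forall c a, I a -> I (c * a)].

Lemma is_idealN I a : is_ideal I -> I a -> I (- a).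
Proof. by move=> [_ _ IM] Ia; rewrite -mulN1r; exact: IM. Qed.

Lemma is_idealB I a b : is_ideal I -> I a -> I b -> I (a - b).
Proof. by move=> idI Ia Ib; have [_ ID _] := idI; apply: ID => //; exact: is_idealN. Qed.

Lemma is_ideal_sum I (T : Type) (r : seq T) (p : pred T) (F : T -> A) :
  is_ideal I -> (forall i, p i -> I (F i)) -> I (\sum_(i <- r | p i) F i).
Proof. by move=> [I0 ID _] IF; apply: big_ind. Qed.

Lemma ideal_gen_is_ideal G : is_ideal (ideal_gen G).
Proof.
split.
- exists 0%N, (fun=> 0), (fun=> 0); split; first by case.
  by rewrite big_ord0.
- move=> _ _ [k [c [g [Gg ->]]]] [l [c' [g' [Gg' ->]]]].
  pose glue T (p : 'I_k -> T) (q : 'I_l -> T) i :=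
    match split i with inl i => p i | inr i => q i end.
  exists (k + l)%N, (glue _ c c'), (glue _ g g'); split.
    by move=> i; rewrite /glue; case: (split i).
  rewrite big_split_ord /=; congr (_ + _); apply: eq_bigr => i _.
    by rewrite /glue (unsplitK (inl i)).
  by rewrite /glue (unsplitK (inr i)).
- move=> a _ [k [c [g [Gg ->]]]]; exists k, (fun i => a * c i), g; split=> //.
  by rewrite mulr_sumr; apply: eq_bigr => i _; rewrite mulrA.
Qed.

Lemma sub_ideal_gen G : G `<=` ideal_gen G.
Proof.
move=> g Gg; exists 1%N, (fun=> 1), (fun=> g); split=> //.
by rewrite big_ord1 mul1r.
Qed.

Lemma ideal_gen_min G I : is_ideal I -> G `<=` I -> ideal_gen G `<=` I.
Proof.
move=> idI GI _ [k [c [g [Gg ->]]]]; have [_ _ IM] := idI.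
by apply: is_ideal_sum => // i _; apply/IM/GI.
Qed.

Lemma ideal_genS G H : G `<=` H -> ideal_gen G `<=` ideal_gen H.
Proof.
move=> GH; apply: ideal_gen_min; first exact: ideal_gen_is_ideal.
exact: (subset_trans GH (@sub_ideal_gen H)).
Qed.

Lemma saturation_is_ideal I g : is_ideal I -> is_ideal (saturation I g).
Proof.
move=> [I0 ID IM]; split.
- by exists 0%N; rewrite mulr0.
- move=> a b [m Ia] [n Ib]; exists (m + n)%N; rewrite mulrDr; apply: ID.
    by rewrite addnC exprD -mulrA; apply: IM.
  by rewrite exprD -mulrA; apply: IM.
- by move=> c a [n Ia]; exists n; rewrite mulrCA; apply: IM.
Qed.

End Ideal.

Lemma preimage_is_ideal (A B : comPzRingType) (phi : {rmorphism A -> B}) (I : set B) :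
  is_ideal I -> is_ideal [set a | I (phi a)].
Proof.
move=> [I0 ID IM]; split=> [|a b|c a] /=; first by rewrite rmorph0.
  by rewrite rmorphD; apply: ID.
by rewrite rmorphM; apply: IM.
Qed.

Section Minors.
Variables (A : comPzRingType) (m n : nat) (M : 'M[A]_(m, n)).

Lemma inj_sortable r (f : 'I_r -> 'I_m) : injective f ->
  exists s : {perm 'I_r}, {homo f \o s : i j / (i < j)%N}.
Proof.
move=> finj; pose leT := relpre (val : 'I_m -> nat) leq.
have : perm_eq (sort leT (codom f)) [tuple f i | i < r].
  by rewrite perm_sort.
move=> /tuple_permP[s sE]; exists s => i j ij /=.
have tr : transitive leT by move=> x y z; exact: leq_trans.
have so : sorted leT (sort leT (codom f)) by apply: sort_sorted => x y; exact: leq_total.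
have sz : size (sort leT (codom f)) = r by rewrite size_sort size_codom card_ord.
have nthE k : nth (f i) (sort leT (codom f)) (k : 'I_r) = f (s k).
  by rewrite sE (nth_map k) ?size_enum_ord // nth_ord_enum tnth_mktuple.
have := sorted_ltn_nth tr (f i) so.
move=> /(_ i j); rewrite !inE sz !ltn_ord !nthE => /(_ isT isT ij).
rewrite /leT /= leq_eqVlt => /orP[/eqP/val_inj/finj/perm_inj eqij|//].
by rewrite eqij ltnn in ij.
Qed.

Lemma det_rowsub_perm r (rs : 'I_r -> 'I_m) (cs : 'I_r -> 'I_n) (s : {perm 'I_r}) :
  \det (mxsub (rs \o s) cs M) = (-1) ^+ s * \det (mxsub rs cs M).
Proof.
rewrite -det_perm -det_mulmx -row_permE; congr (\det _).
by apply/matrixP => i j; rewrite !mxE.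
Qed.

Lemma det_colsub_perm r (rs : 'I_r -> 'I_m) (cs : 'I_r -> 'I_n) (s : {perm 'I_r}) :
  \det (mxsub rs (cs \o s) M) = (-1) ^+ s * \det (mxsub rs cs M).
Proof.
rewrite mulrC -[in RHS]odd_permV -det_perm -det_mulmx -col_permE; congr (\det _).
by apply/matrixP => i j; rewrite !mxE.
Qed.

End Minors.

(** Frees minors from increasing index maps: a repeated row or column gives 0, and sorting costs
    only a sign. *)
Lemma minors_mxsub (A : comPzRingType) (m n r : nat) (M : 'M[A]_(m, n))
    (rs : 'I_r -> 'I_m) (cs : 'I_r -> 'I_n) :
  ideal_gen (minors r M) (\det (mxsub rs cs M)).
Proof.
have idI := ideal_gen_is_ideal (minors r M); have [I0 _ IM] := idI.
have [/injectiveP rinj|/injectivePn[i [j ij E]]] := boolP (injectiveb rs); last first.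
  by rewrite (determinant_alternate ij) // => k; rewrite !mxE E.
have [/injectiveP cinj|/injectivePn[i [j ij E]]] := boolP (injectiveb cs); last first.
  by rewrite -det_tr (determinant_alternate ij) // => k; rewrite !mxE E.
have [s hs] := inj_sortable rinj; have [t ht] := inj_sortable cinj.
have : ideal_gen (minors r M) (\det (mxsub (rs \o s) (cs \o t) M)).
  by apply: sub_ideal_gen; exists (rs \o s), (cs \o t).
rewrite det_rowsub_perm det_colsub_perm.
move=> /(IM ((-1) ^+ s)); rewrite signrMK.
by move=> /(IM ((-1) ^+ t)); rewrite signrMK.
Qed.

(** The rows outside the image of [f] are expanded one at a time. *)
Lemma laplace_rows (A : comPzRingType) (m n k : nat) (M : 'M[A]_(m, n))
    (rf : 'I_k -> 'I_m) r (rs : 'I_r -> 'I_m) (cs : 'I_r -> 'I_n) (f : 'I_k -> 'I_r) :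
  injective f -> rs \o f =1 rf ->
  ideal_gen [set \det (mxsub rf c M) | c in [set: 'I_k -> 'I_n]] (\det (mxsub rs cs M)).
Proof.
set G := [set _ | _ in _]; have idI := ideal_gen_is_ideal G; have [I0 _ IM] := idI.
(* Once no row is left to expand, [f'] is a permutation and the determinant is a generator up to
   sign. *)
have onto_case r' (rs' : 'I_r' -> 'I_m) (cs' : 'I_r' -> 'I_n) (f' : 'I_k -> 'I_r') :
    injective f' -> rs' \o f' =1 rf -> (forall i, i \in codom f') ->
    ideal_gen G (\det (mxsub rs' cs' M)).
  move=> finj fE onto; have kr : k = r'.
    have := card_codom finj; rewrite card_ord => <-.
    by rewrite (eq_card (B := 'I_r')) ?card_ord // => i; rewrite onto.
  case: _ / kr rs' cs' f' finj fE onto => rs' cs' f' finj fE _.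
  rewrite -[\det _](signrMK (perm finj)) -det_rowsub_perm; apply: IM.
  apply: sub_ideal_gen; exists cs' => //; congr (\det _).
  by apply/matrixP => i j; rewrite !mxE -fE /= permE.
elim: r rs cs f => [|r IHr] rs cs f finj fE;
    have [[i fi]|nex] := pselect (exists i, i \notin codom f); try by case: i fi.
1,3: apply: (onto_case _ _ _ f) => // i; apply/negPn/negP => fi; apply: nex; by exists i.
rewrite (expand_det_row _ i); apply: is_ideal_sum => // j _.
  rewrite /cofactor mulrA; apply: IM.
  have -> : row' i (col' j (mxsub rs cs M)) = mxsub (rs \o lift i) (cs \o lift j) M.
    by apply/matrixP => a b; rewrite !mxE.
  have /boolp.choice[f' f'E] a : exists b, f a = lift i b.
    case: (unliftP i (f a)) => [b ->|E]; first by exists b.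
    by move: fi; rewrite -E codom_f.
  apply: (IHr _ _ f') => [a b E|a]; last by rewrite -fE /= f'E.
  by apply: finj; rewrite !f'E E.
Qed.

(** * Sums of ideals in disjoint sets of variables *)

Section JoinIdeal.
Variables (K : fieldType) (n1 n2 n : nat).
Local Notation A := {mpoly K[n1]}.
Local Notation B := {mpoly K[n2]}.
Local Notation C := {mpoly K[n]}.
Variables (iA : {rmorphism A -> C}) (iB : {rmorphism B -> C}).

Definition join_ideal (IA : set A) (IB : set B) : set C :=
  ideal_gen (iA @` IA `|` iB @` IB).

Variable phi : {rmorphism C -> {mpoly B[n1]}}.
Hypothesis phiA : forall a m, (phi (iA a))@_m = (a@_m)%:MP.
Hypothesis phiB : forall b, phi (iB b) = b%:MP.
Hypothesis iAB : forall c, iA c%:MP = iB c%:MP.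

(** The list represents an element of the tensor product of [A] and [B]; relations between such sums
    are detected by [phi], which reads off the coefficient in [B] of each monomial of [A]. *)
Definition tens (s : seq (A * B)) : C := \sum_(p <- s) iA p.1 * iB p.2.

Hypothesis tens_surj : forall z, exists s, z = tens s.

Variables (IA : set A) (IB : set B).
Hypotheses (idA : is_ideal IA) (idB : is_ideal IB).

Let IBC : set C := ideal_gen (iB @` IB).
Let idIBC : is_ideal IBC. Proof. exact: ideal_gen_is_ideal. Qed.

Lemma iAZ c p b : iA (c *: p) * iB b = iA p * iB (c *: b).
Proof. by rewrite -!mul_mpolyC !rmorphM /= iAB mulrCA mulrA mulrAC mulrC mulrA. Qed.

Lemma IB_scale c b : IB b -> IB (c *: b).
Proof. by rewrite -mul_mpolyC; case: idB => _ _; apply. Qed.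

Lemma IBC_tens a b : IB b -> IBC (iA a * iB b).
Proof. by move=> Ib; have [_ _ IM] := idIBC; apply/IM/sub_ideal_gen; exists b. Qed.

(** Turns a membership in [C] into one membership in [B] for each monomial of [A]. *)
Lemma IBC_coef z m : IBC z -> IB (phi z)@_m.
Proof.
move: m => + Iz; suff : IBC `<=` [set z | forall m, IB (phi z)@_m] by apply.
have [I0 ID IM] := idB; apply: ideal_gen_min.
  split=> [m|a b Ia Ib m|c a Ia m].
  - by rewrite rmorph0 mcoeff0.
  - by rewrite rmorphD mcoeffD; apply: ID.
  - by rewrite rmorphM mcoeffM; apply: is_ideal_sum => // k _; apply: IM.
move=> _ [b Ib <-] m; rewrite phiB mcoeffC mulrC; exact: IM.
Qed.

(** The [K]-span of [bs] modulo [IB], tested by removing one generator at a time; [independent] is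
    linear independence in the quotient by [IB]. *)
Fixpoint in_span (bs : seq B) (x : B) : Prop :=
  if bs is b :: bs' then exists c, in_span bs' (x + c *: b) else IB x.

Fixpoint independent (bs : seq B) : Prop :=
  if bs is b :: bs' then ~ in_span bs' b /\ independent bs' else True.

Lemma in_spanZ a bs x : in_span bs x -> in_span bs (a *: x).
Proof.
elim: bs x => [|b bs IH] x /=; first exact: IB_scale.
by move=> [c /IH]; rewrite scalerDr scalerA => H; exists (a * c).
Qed.

Lemma in_span_sum (s : seq (K * B)) x :
  IB (x + \sum_(p <- s) p.1 *: p.2) -> in_span (map snd s) x.
Proof.
elim: s x => [|[c b] s IH] x /=; first by rewrite big_nil addr0.
by rewrite big_cons addrA => /IH; exists c.
Qed.

Lemma independentP (s : seq (K * B)) : independent (map snd s) ->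
  IB (\sum_(p <- s) p.1 *: p.2) -> forall p, p \in s -> p.1 = 0.
Proof.
elim: s => [|[c b] s IH] //= [nb ind]; rewrite big_cons /= => Is.
have c0 : c = 0.
  have [//|c0] := eqVneq c 0; case: nb.
  by have := in_spanZ c^-1 (in_span_sum Is); rewrite scalerA mulVf // scale1r.
move: Is; rewrite c0 scale0r add0r => /(IH ind) H p.
by rewrite inE => /orP[/eqP ->|/H].
Qed.

Lemma tens_cons p s : tens (p :: s) = iA p.1 * iB p.2 + tens s.
Proof. exact: big_cons. Qed.

Lemma tens_cat s t : tens (s ++ t) = tens s + tens t.
Proof. exact: big_cat. Qed.

Lemma tens_mulA a s : iA a * tens s = tens [seq (a * p.1, p.2) | p <- s].
Proof. by rewrite /tens mulr_sumr big_map; apply: eq_bigr => p _; rewrite rmorphM mulrA. Qed.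

Lemma tens_mulB b s : iB b * tens s = tens [seq (p.1, b * p.2) | p <- s].
Proof. by rewrite /tens mulr_sumr big_map; apply: eq_bigr => p _; rewrite rmorphM mulrCA. Qed.

Lemma phi_tens s m : (phi (tens s))@_m = \sum_(p <- s) p.1@_m *: p.2.
Proof.
rewrite /tens !raddf_sum /=; apply: eq_bigr => p _.
by rewrite rmorphM /= phiB mulrC mcoeffCM phiA mulrC mul_mpolyC.
Qed.

(** For each monomial, the coefficients of the left factors form a [K]-linear relation modulo [IB]
    among the independent right factors. *)
Lemma tens_IBC_eq0 s : independent (map snd s) -> IBC (tens s) ->
  forall p, p \in s -> p.1 = 0.
Proof.
move=> ind Is p ps; apply/mpolyP => m; rewrite mcoeff0.
pose t := [seq (q.1@_m, q.2) | q <- s].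
have tE : map snd t = map snd s by rewrite -map_comp.
apply: (@independentP t _ _ (p.1@_m, p.2)); first by rewrite tE.
  by rewrite big_map -phi_tens; apply: IBC_coef.
by apply/mapP; exists p.
Qed.

(** Expanding [b] along the right factors of [s] changes each left factor by a scalar multiple of
    [p], so when [p] is in [IA] membership of the left factors in [IA] is not affected. *)
Lemma tens_absorb s p b : in_span (map snd s) b -> exists s',
  [/\ map snd s' = map snd s, IBC (tens s + iA p * iB b - tens s') &
     IA p -> (forall q, q \in s' -> IA q.1) -> forall q, q \in s -> IA q.1].
Proof.
elim: s b => [|[a b'] s IH] b /=.
  move=> Ib; exists [::]; split=> //.
  by rewrite /tens big_nil add0r subr0; exact: IBC_tens.
move=> [c /IH[s' [E Is' H]]]; exists ((a - c *: p, b') :: s'); split.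
- by rewrite /= E.
- rewrite !tens_cons /= rmorphB mulrBl iAZ.
  suff -> : iA a * iB b' + tens s + iA p * iB b
      - (iA a * iB b' - iA p * iB (c *: b') + tens s') =
      tens s + iA p * iB (b + c *: b') - tens s' by [].
  rewrite rmorphD mulrDr; ring.
- move=> Ip all' q; rewrite inE => /orP[/eqP ->|]; last first.
    by apply: H => // r rs'; apply: all'; rewrite inE rs' orbT.
  have [_ ID IM] := idA; rewrite -[X in IA X](subrK (c *: p)); apply: ID.
    by apply: (all' (a - c *: p, b')); rewrite inE eqxx.
  by rewrite -mul_mpolyC; apply: IM.
Qed.

(* The right factors of q extend those of s to a family that is independent modulo IB;
   comparing coefficients along it shows that the left factors of s come from IA. *)
Lemma tens_coef_IA s q : (forall p, p \in q -> IA p.1) ->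
  independent (map snd s) -> IBC (tens s - tens q) -> forall p, p \in s -> IA p.1.
Proof.
have [I0 ID IM] := idA; have [J0 JD JM] := idIBC.
elim: q s => [|[a b] q IH] s qA ind.
  rewrite [tens [::]]big_nil subr0 => Is p /(tens_IBC_eq0 ind Is) ->; exact: I0.
have Ia : IA a by apply: (qA (a, b)); rewrite inE eqxx.
have {}qA p : p \in q -> IA p.1 by move=> pq; apply: qA; rewrite inE pq orbT.
rewrite tens_cons /= => Is.
have [sp|nsp] := pselect (in_span (map snd s) b).
  have [s' [E Is' H]] := tens_absorb (- a) sp.
  have {}Ia : IA (- a) by exact: is_idealN.
  apply: H => //; apply: (IH s') => //; first by rewrite E.
  have := is_idealB idIBC Is Is'; congr IBC; rewrite rmorphN; ring.
move=> p ps; apply: (IH ((- a, b) :: s)) => //; last by rewrite inE ps orbT.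
by rewrite tens_cons /= rmorphN; move: Is; congr IBC; ring.
Qed.

(** Pairs of [q] are processed in turn: one with a dependent right factor is absorbed, any other
    extends the family. *)
Lemma tens_independent q s : independent (map snd s) -> exists s',
  independent (map snd s') /\ IBC (tens s + tens q - tens s').
Proof.
have [J0 JD JM] := idIBC.
elim: q s => [|[a b] q IH] s ind.
  by exists s; split=> //; rewrite [tens [::]]big_nil addr0 subrr.
rewrite tens_cons /=; have [sp|nsp] := pselect (in_span (map snd s) b).
  have [s' [E Is' _]] := tens_absorb a sp.
  have [|s'' [ind' Is'']] := IH s'; first by rewrite E.
  exists s''; split=> //; have := JD _ _ Is' Is''; congr IBC; ring.
have [|s' [ind' Is']] := IH ((a, b) :: s); first by [].
exists s'; split=> //; move: Is'; rewrite tens_cons /=; congr IBC; ring.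
Qed.

(** The elements of this form are stable under multiplication by both images, hence by all of [C]
    because [tens] is surjective. *)
Lemma join_idealP z : join_ideal IA IB z ->
  exists q, (forall p, p \in q -> IA p.1) /\ IBC (z - tens q).
Proof.
have [I0 ID IM] := idA; have [J0 JD JM] := idIBC.
pose X := [set z | exists q, (forall p, p \in q -> IA p.1) /\ IBC (z - tens q)].
have X0 : X 0 by exists [::]; split=> //; rewrite [tens _]big_nil subr0.
have XD x y : X x -> X y -> X (x + y).
  move=> [q [qA xq]] [r [rA yr]]; exists (q ++ r); split.
    by move=> p; rewrite mem_cat => /orP[/qA|/rA].
  by rewrite tens_cat; have := JD _ _ xq yr; congr IBC; ring.
have XA a x : X x -> X (iA a * x).
  move=> [q [qA xq]]; exists [seq (a * p.1, p.2) | p <- q]; split.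
    by move=> _ /mapP[p /qA pA ->]; apply: IM.
  by rewrite -tens_mulA -mulrBr; apply: JM.
have XB b x : X x -> X (iB b * x).
  move=> [q [qA xq]]; exists [seq (p.1, b * p.2) | p <- q]; split.
    by move=> _ /mapP[p /qA pA ->].
  by rewrite -tens_mulB -mulrBr; apply: JM.
move: z; apply: ideal_gen_min; first split=> // c x Xx.
  have [r ->] := tens_surj c; rewrite /tens mulr_suml.
  by apply: (big_ind X) => // p _; rewrite -mulrA; apply/XA/XB.
move=> _ [[a Ia <-]|[b Ib <-]].
  exists [:: (a, 1)]; split; first by move=> p; rewrite inE => /eqP ->.
  by rewrite /tens big_seq1 rmorph1 mulr1 subrr.
exists [::]; split=> //; rewrite [tens _]big_nil subr0; apply: sub_ideal_gen.
by exists b.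
Qed.

(** If [z] is written with independent right factors, [iA g ^+ N] acts on the left factors alone, so
    saturation of [IA] applies to each of them. *)
Lemma join_ideal_saturated g N z : (forall a, IA (g ^+ N * a) -> IA a) ->
  join_ideal IA IB (iA g ^+ N * z) -> join_ideal IA IB z.
Proof.
move=> sat /join_idealP[q [qA Iz]]; have [r zE] := tens_surj z.
have [|s [ind Is]] := @tens_independent r [::]; first by [].
rewrite [tens [::]]big_nil add0r -zE in Is.
have [_ JD JM] := idIBC; have [_ CD CM] := ideal_gen_is_ideal (iA @` IA `|` iB @` IB).
have sA p : p \in s -> IA p.1.
  move=> ps; apply: sat; pose t := [seq (g ^+ N * p.1, p.2) | p <- s].
  have indt : independent (map snd t) by rewrite -map_comp.
  have It : IBC (tens t - tens q).
    rewrite -tens_mulA rmorphXn.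
    have := is_idealB idIBC Iz (JM (iA g ^+ N) _ Is); congr IBC; ring.
  by apply: (tens_coef_IA qA indt It (p := (g ^+ N * p.1, p.2))); apply/mapP; exists p.
rewrite -[z](subrK (tens s)); apply: CD.
  move: Is; apply: ideal_genS => _ [b Ib <-]; right; exists b => //.
rewrite /tens big_seq; apply: is_ideal_sum => [|p ps]; first exact: ideal_gen_is_ideal.
rewrite mulrC; apply/CM/sub_ideal_gen; left; exists p.1 => //; exact: sA.
Qed.

(** The one-element family 1 is independent modulo [IB] because [IB] is proper, and [iA a] has [a]
    as its left factor. *)
Lemma join_ideal_left a : ~ IB 1 -> join_ideal IA IB (iA a) -> IA a.
Proof.
move=> nB /join_idealP[q [qA Iz]].
have ind : independent (map snd [:: (a, 1 : B)]) by [].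
have Ia : IBC (tens [:: (a, 1)] - tens q).
  by rewrite [tens [:: _]]big_seq1 rmorph1 mulr1.
by apply: (tens_coef_IA qA ind Ia (p := (a, 1))); rewrite inE.
Qed.

End JoinIdeal.

(** * Descent to the rationals *)

Section CharZero.
Variables (K : fieldType) (charK : [pchar K] =i pred0).

Let intr_eq0K (z : int) : (z%:~R == 0 :> K) = (z == 0).
Proof.
by case: z => n; rewrite ?NegzE ?mulrNz ?oppr_eq0 ((pcharf0P K).1 charK).
Qed.

(** In characteristic zero denominators stay nonzero in [K], so [ratr] may be computed on fractions
    not in lowest terms. *)
Lemma ratr_frac (a b : int) : b != 0 -> ratr (a%:~R / b%:~R) = a%:~R / b%:~R :> K.
Proof.
move=> b0; set x := _ / _; have d0 : denq x != 0 by rewrite denq_neq0.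
have E : numq x * b = a * denq x.
  apply: (@intr_inj rat); rewrite !intrM; apply/eqP.
  by rewrite -eqr_div ?intr_eq0 // divq_num_den.
rewrite /ratr; apply/eqP; rewrite eqr_div ?intr_eq0K //.
by rewrite -!intrM E.
Qed.

Fact ratr_charZero_zmod : zmod_morphism (ratr : rat -> K).
Proof.
move=> x y; have dx := denq_neq0 x; have dy := denq_neq0 y.
rewrite -{1}(divq_num_den x) -{1}(divq_num_den y).
have -> : (numq x)%:~R / (denq x)%:~R - (numq y)%:~R / (denq y)%:~R =
    (numq x * denq y - numq y * denq x)%:~R / (denq x * denq y)%:~R :> rat.
  by rewrite intrB !intrM; field; rewrite !intr_eq0 dx dy.
rewrite ratr_frac ?mulf_neq0 // intrB !intrM /ratr.
by field; rewrite !intr_eq0K dx dy.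
Qed.

Fact ratr_charZero_monoid : monoid_morphism (ratr : rat -> K).
Proof.
split=> [|x y]; first by rewrite -[1](divr1 1) (@ratr_frac 1 1) // divr1.
have dx := denq_neq0 x; have dy := denq_neq0 y.
rewrite -{1}(divq_num_den x) -{1}(divq_num_den y).
have -> : (numq x)%:~R / (denq x)%:~R * ((numq y)%:~R / (denq y)%:~R) =
    (numq x * numq y)%:~R / (denq x * denq y)%:~R :> rat.
  by rewrite !intrM; field; rewrite !intr_eq0 dx dy.
rewrite ratr_frac ?mulf_neq0 // !intrM /ratr.
by field; rewrite !intr_eq0K dx dy.
Qed.

Lemma rat_rmorphism : exists f : {rmorphism rat -> K}, True.
Proof.
pose a := GRing.isZmodMorphism.Build rat K ratr ratr_charZero_zmod.
pose b := GRing.isMonoidMorphism.Build rat K ratr ratr_charZero_monoid.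
pose g : {rmorphism rat -> K} := HB.pack (ratr : rat -> K) a b.
by exists g.
Qed.

End CharZero.

Section Descent.
Variables (F K : fieldType) (f : {rmorphism F -> K}) (n : nat).
Local Notation mapf := (@map_mpoly n F K f).

(** A linear system over [F] that is solvable over the extension [K] is solvable over [F]. *)
Lemma linear_descent (I : eqType) (s : seq I) (w : I -> {mpoly F[n]}) (c : I -> K) t :
  mapf t = \sum_(i <- s) c i *: mapf (w i) ->
  exists c' : 'I_(size s) -> F, t = \sum_(i < size s) c' i *: w (tnth (in_tuple s) i).
Proof.
move=> E; pose ws i := w (tnth (in_tuple s) i).
(* Finitely many monomials suffice to state the equality as a matrix equation. *)
pose ms := msupp t ++ flatten [seq msupp (w i) | i <- s].
pose mon (j : 'I_(size ms)) := tnth (in_tuple ms) j.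
pose M := \matrix_(i < size s, j < size ms) (ws i)@_(mon j).
pose T := \row_(j < size ms) t@_(mon j).
have : (map_mx f T <= map_mx f M)%MS.
  apply/submxP; exists (\row_i c (tnth (in_tuple s) i)); apply/rowP => j.
  rewrite !mxE -mcoeff_map_mpoly E raddf_sum /= big_tnth; apply: eq_bigr => i _.
  by rewrite !mxE mcoeffZ mcoeff_map_mpoly.
rewrite map_submx => /submxP[D TD]; exists (fun i => D 0 i); apply/mpolyP => m.
rewrite raddf_sum /=; have [/(tnthP (in_tuple ms))[j ->]|mms] := boolP (m \in ms).
  have := congr1 (fun X : 'rV_(size ms) => X 0 j) TD; rewrite !mxE => ->.
  by apply: eq_bigr => i _; rewrite !mxE mcoeffZ.
rewrite memN_msupp_eq0; last by apply: contra mms => mt; rewrite mem_cat mt.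
rewrite big1 // => i _; rewrite mcoeffZ memN_msupp_eq0 ?mulr0 //.
apply: contra mms => mw; rewrite mem_cat; apply/orP; right; apply/flattenP.
by exists (msupp (ws i)) => //; apply/mapP; exists (tnth (in_tuple s) i); rewrite ?mem_tnth.
Qed.

Lemma ideal_descent (G : set {mpoly F[n]}) t :
  ideal_gen (mapf @` G) (mapf t) -> ideal_gen G t.
Proof.
have idG := ideal_gen_is_ideal G; have [I0 ID IM] := idG.
(* Monomials are defined over [F], so polynomial multipliers over [K] can be reduced to scalars of
   [K], and linear algebra applies. *)
pose X := [set z | exists s : seq (K * {mpoly F[n]}),
  (forall p, p \in s -> ideal_gen G p.2) /\ z = \sum_(p <- s) p.1 *: mapf p.2].
have X0 : X 0 by exists [::]; rewrite big_nil.
have XD x y : X x -> X y -> X (x + y).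
  move=> [q [qA ->]] [r [rA ->]]; exists (q ++ r); rewrite big_cat; split=> // p.
  by rewrite mem_cat => /orP[/qA|/rA].
have XM c m x : X x -> X (c *: 'X_[m] * x).
  move=> [q [qA ->]]; exists [seq (c * p.1, 'X_[m] * p.2) | p <- q]; split.
    by move=> _ /mapP[p /qA pA ->]; apply: IM.
  rewrite big_map mulr_sumr; apply: eq_bigr => p _ /=.
  by rewrite rmorphM /= map_mpolyX -scalerAl -!scalerAr scalerA.
have idX : is_ideal X.
  split=> // c x Xx; rewrite [c]mpolyE mulr_suml.
  by apply: (big_ind X) => // m _; apply: XM.
have GX : mapf @` G `<=` X.
  move=> _ [g Gg <-]; exists [:: (1, g)]; rewrite big_seq1 scale1r; split=> //.
  by move=> p; rewrite inE => /eqP ->; apply: sub_ideal_gen.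
move=> /(ideal_gen_min idX GX)[s [sG tE]].
have [c' ->] := linear_descent tE.
apply: is_ideal_sum => // i _; rewrite -mul_mpolyC; apply: IM; apply: sG.
exact: mem_tnth.
Qed.

End Descent.

(** * Symbolic slack matrices with block diagonal support *)

Section Substitution.
Variables (R : realType) (K : fieldType) (m n : nat) (S : 'M[R]_(m, n)).
Local Notation A := {mpoly K[#|nonzeros S|]}.

Lemma symbolic_slack0 i j : S i j = 0 -> symbolic_slack K S i j = 0.
Proof.
move=> Sij; rewrite mxE; case: pickP => // k /eqP kE.
by have := enum_valP k; rewrite kE inE /= Sij eqxx.
Qed.

Lemma symbolic_slack_val k :
  symbolic_slack K S (enum_val k).1 (enum_val k).2 = 'X_k :> A.
Proof.
rewrite mxE; case: pickP => [k' /eqP|/(_ k)]; last by rewrite -surjective_pairing eqxx.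
by rewrite -surjective_pairing => /enum_val_inj ->.
Qed.

Lemma nonzero_index i j : S i j != 0 -> exists k : 'I_#|nonzeros S|, enum_val k = (i, j).
Proof.
move=> Sij; have ijS : (i, j) \in nonzeros S by rewrite inE.
by exists (enum_rank_in ijS (i, j)); rewrite enum_rankK_in.
Qed.

Variables (L : comNzRingType) (f : {rmorphism K -> L}) (w : 'I_m -> 'I_n -> L).

Definition subst_slack : A -> L :=
  mmap f (fun k => w (enum_val k).1 (enum_val k).2).

HB.instance Definition _ := GRing.RMorphism.copy subst_slack
  (mmap f (fun k => w (enum_val k).1 (enum_val k).2)).

Lemma subst_slackC c : subst_slack c%:MP = f c.
Proof. exact: mmapC. Qed.

Lemma subst_slack_symb i j : S i j != 0 -> subst_slack (symbolic_slack K S i j) = w i j.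
Proof.
move=> /nonzero_index[k kE].
have := symbolic_slack_val k; rewrite kE /= => ->.
by rewrite /subst_slack mmapX mmap1U kE.
Qed.

Lemma slack_morph_ext (g h : {rmorphism A -> L}) :
  (forall c, g c%:MP = h c%:MP) ->
  (forall i j, S i j != 0 -> g (symbolic_slack K S i j) = h (symbolic_slack K S i j)) ->
  g =1 h.
Proof.
move=> EC EX p; rewrite [p]mpolyE !rmorph_sum /=; apply: eq_bigr => mm _.
rewrite -mul_mpolyC !rmorphM EC mpolyXE_id !rmorph_prod; congr (_ * _).
apply: eq_bigr => k _; rewrite !rmorphXn -symbolic_slack_val EX //.
by have := enum_valP k; rewrite inE.
Qed.

End Substitution.

Arguments subst_slack {R K m n} S {L} f w _.

(* K need not embed in R, but a power of the product of the variables that is a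
   combination of minors over K is one over rat already. *)
Lemma one_notin_slack_ideal (R : realType) (K : fieldType) (charK : [pchar K] =i pred0)
    n (P : set 'rV[R]_n) m k (S : 'M[R]_(m, k)) :
  is_slack_matrix P S -> ~ slack_ideal K S n 1.
Proof.
move=> slackS [N]; rewrite mulr1 => H.
have [f _] := rat_rmorphism charK.
pose MQ := minors (n + 2) (symbolic_slack rat S).
pose XQ : {mpoly rat[#|nonzeros S|]} := \prod_(i < #|nonzeros S|) 'X_i.
have mapS i j : map_mpoly f (symbolic_slack rat S i j) = symbolic_slack K S i j.
  by rewrite !mxE; case: pickP => [l _|_]; rewrite ?map_mpolyX ?rmorph0.
have : ideal_gen (map_mpoly f @` MQ) (map_mpoly f (XQ ^+ N)).
  rewrite rmorphXn rmorph_prod /= (eq_bigr (fun i => 'X_i)) => [|i _]; last exact: map_mpolyX.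
  apply: ideal_genS H => _ [rs [cs [hr hc ->]]].
  exists (\det (mxsub rs cs (symbolic_slack rat S))); first by exists rs, cs.
  rewrite -det_map_mx; congr (\det _).
  apply/matrixP => i j; transitivity (map_mpoly f (symbolic_slack rat S (rs i) (cs j))).
    by rewrite !mxE.
  by rewrite mapS [RHS]mxE.
move=> /ideal_descent/= XM.
pose ev : {rmorphism _ -> R} := subst_slack S (ratr : {rmorphism rat -> R}) (fun i j => S i j).
have evS i j : S i j != 0 -> ev (symbolic_slack rat S i j) = S i j.
  exact: subst_slack_symb.
have ev0 : MQ `<=` [set p | ev p = 0].
  move=> _ [rs [cs [_ _ ->]]] /=; rewrite -det_map_mx.
  rewrite -[RHS](slack_minor0 rs cs slackS) ?addn2 //; congr (\det _).
  apply/matrixP => i j; transitivity (ev (symbolic_slack rat S (rs i) (cs j))).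
    by rewrite !mxE.
  rewrite [RHS]mxE; have [S0|Sn] := eqVneq (S (rs i) (cs j)) 0; last by rewrite evS.
  by rewrite symbolic_slack0 // rmorph0 S0.
have id0 : is_ideal [set p | ev p = 0].
  apply: (@preimage_is_ideal _ _ ev [set 0]); split=> //.
    by move=> _ _ -> ->; exact: addr0.
  by move=> c _ ->; exact: mulr0.
have /eqP := ideal_gen_min id0 ev0 XM; rewrite rmorphXn rmorph_prod.
rewrite expf_eq0 prodf_seq_eq0 => /andP[_ /hasP[i _ /=]].
have := enum_valP i; rewrite inE => Si.
by rewrite -symbolic_slack_val evS // (negPf Si).
Qed.

Definition sum_swap (T U : Type) (x : T + U) : U + T :=
  match x with inl y => inr y | inr y => inl y end.

(** The inverses are carried as data: morphisms out of the ring of the join read from them the block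
    and position of each variable. *)
Definition block_iso (R : realType) mP nP mQ nQ mJ nJ
    (SP : 'M[R]_(mP, nP)) (SQ : 'M[R]_(mQ, nQ)) (SJ : 'M[R]_(mJ, nJ))
    (s : 'I_mP + 'I_mQ -> 'I_mJ) s' (t : 'I_nP + 'I_nQ -> 'I_nJ) t' :=
  [/\ cancel s s', cancel s' s, cancel t t', cancel t' t &
      forall i j, (SJ (s i) (t j) != 0) = block_support SP SQ i j].

(** With the swapped bijections [embedP] computes to the former [embedQ], so each result on the
    first block applies to the second. *)
Lemma block_iso_swap (R : realType) mP nP mQ nQ mJ nJ
    (SP : 'M[R]_(mP, nP)) (SQ : 'M[R]_(mQ, nQ)) (SJ : 'M[R]_(mJ, nJ)) s s' t t' :
  block_iso SP SQ SJ s s' t t' ->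
  block_iso SQ SP SJ (s \o @sum_swap _ _) (@sum_swap _ _ \o s')
    (t \o @sum_swap _ _) (@sum_swap _ _ \o t').
Proof.
move=> [sK sK' tK tK' E]; split=> [i|i|i|i|i j] /=.
- by rewrite sK; case: i.
- by rewrite -[RHS]sK'; case: (s' i).
- by rewrite tK; case: i.
- by rewrite -[RHS]tK'; case: (t' i).
- by rewrite E; case: i; case: j.
Qed.

Section Block.
Variables (R : realType) (K : fieldType) (mP nP mQ nQ mJ nJ : nat).
Variables (SP : 'M[R]_(mP, nP)) (SQ : 'M[R]_(mQ, nQ)) (SJ : 'M[R]_(mJ, nJ)).
Variables (s : 'I_mP + 'I_mQ -> 'I_mJ) (s' : 'I_mJ -> 'I_mP + 'I_mQ).
Variables (t : 'I_nP + 'I_nQ -> 'I_nJ) (t' : 'I_nJ -> 'I_nP + 'I_nQ).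
Hypothesis iso : block_iso SP SQ SJ s s' t t'.

Local Notation A := {mpoly K[#|nonzeros SP|]}.
Local Notation B := {mpoly K[#|nonzeros SQ|]}.
Local Notation C := {mpoly K[#|nonzeros SJ|]}.
Local Notation XP := (symbolic_slack K SP).
Local Notation XQ := (symbolic_slack K SQ).
Local Notation XJ := (symbolic_slack K SJ).

Definition embedP : A -> C :=
  subst_slack SP (@mpolyC #|nonzeros SJ| K) (fun i j => XJ (s (inl i)) (t (inl j))).
HB.instance Definition _ := GRing.RMorphism.on embedP.

Definition embedQ : B -> C :=
  subst_slack SQ (@mpolyC #|nonzeros SJ| K) (fun i j => XJ (s (inr i)) (t (inr j))).
HB.instance Definition _ := GRing.RMorphism.on embedQ.

Let supp i j : (SJ (s i) (t j) != 0) = block_support SP SQ i j.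
Proof. by case: iso. Qed.

Lemma embedP_symb i j : embedP (XP i j) = XJ (s (inl i)) (t (inl j)).
Proof.
have [S0|Sn] := eqVneq (SP i j) 0; last by rewrite /embedP subst_slack_symb.
rewrite symbolic_slack0 // rmorph0 symbolic_slack0 //.
by apply/eqP/negPn; rewrite supp /= S0 eqxx.
Qed.

Lemma embedQ_symb i j : embedQ (XQ i j) = XJ (s (inr i)) (t (inr j)).
Proof.
have [S0|Sn] := eqVneq (SQ i j) 0; last by rewrite /embedQ subst_slack_symb.
rewrite symbolic_slack0 // rmorph0 symbolic_slack0 //.
by apply/eqP/negPn; rewrite supp /= S0 eqxx.
Qed.

Lemma symb_PQ i j : XJ (s (inl i)) (t (inr j)) = 0.
Proof. by apply: symbolic_slack0; apply/eqP/negPn; rewrite supp. Qed.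

Lemma symb_QP i j : XJ (s (inr i)) (t (inl j)) = 0.
Proof. by apply: symbolic_slack0; apply/eqP/negPn; rewrite supp. Qed.

(* C viewed as polynomials over B in the variables of SP. *)
Definition coefP : C -> {mpoly B[#|nonzeros SP|]} :=
  subst_slack SJ (@mpolyC #|nonzeros SP| B \o @mpolyC #|nonzeros SQ| K) (fun i j =>
    match s' i, t' j with
    | inl i', inl j' => map_mpoly (@mpolyC #|nonzeros SQ| K) (XP i' j')
    | inr i', inr j' => (XQ i' j')%:MP
    | _, _ => 0
    end).
HB.instance Definition _ := GRing.RMorphism.on coefP.

Lemma coefP_embedP a m : (coefP (embedP a))@_m = (a@_m)%:MP.
Proof.
rewrite -mcoeff_map_mpoly; congr mcoeff.
apply: (@slack_morph_ext _ _ _ _ _ _ (coefP \o embedP) (map_mpoly (@mpolyC _ K))).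
  by move=> c /=; rewrite /embedP /coefP !subst_slackC map_mpolyC.
move=> i j Sij; have [sK _ tK _ _] := iso.
by rewrite /= embedP_symb /coefP subst_slack_symb ?supp // sK tK.
Qed.

Lemma coefP_embedQ b : coefP (embedQ b) = b%:MP.
Proof.
apply: (@slack_morph_ext _ _ _ _ _ _ (coefP \o embedQ) (@mpolyC _ B)).
  by move=> c /=; rewrite /embedQ /coefP !subst_slackC.
move=> i j Sij; have [sK _ tK _ _] := iso.
by rewrite /= embedQ_symb /coefP subst_slack_symb ?supp // sK tK.
Qed.

Lemma embed_const c : embedP c%:MP = embedQ c%:MP.
Proof. by rewrite /embedP /embedQ !subst_slackC. Qed.

Lemma symb_cases k : (exists i j, 'X_k = embedP (XP i j)) \/ (exists i j, 'X_k = embedQ (XQ i j)).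
Proof.
have := enum_valP k; rewrite -symbolic_slack_val inE.
have [_ sK _ tK _] := iso.
rewrite -[(enum_val k).1]sK -[(enum_val k).2]tK supp.
case: (s' _) => i; case: (t' _) => j //= _.
  by left; exists i, j; rewrite embedP_symb.
by right; exists i, j; rewrite embedQ_symb.
Qed.

(** Every variable of [C] comes from one of the two blocks, and constants come from both. *)
Lemma embed_tens z : exists r, z = tens embedP embedQ r.
Proof.
pose X := [set z | exists r, z = tens embedP embedQ r].
have X0 : X 0 by exists [::]; rewrite /tens big_nil.
have XD x y : X x -> X y -> X (x + y).
  by move=> [q ->] [r ->]; exists (q ++ r); rewrite tens_cat.
have mulXP a x : X x -> X (embedP a * x).
  by move=> [q ->]; exists [seq (a * p.1, p.2) | p <- q]; rewrite tens_mulA.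
have mulXQ b x : X x -> X (embedQ b * x).
  by move=> [q ->]; exists [seq (p.1, b * p.2) | p <- q]; rewrite tens_mulB.
suff : X z by [].
rewrite [z]mpolyE; apply: (big_ind X) => // m _.
rewrite -mul_mpolyC -(@subst_slackC R K _ _ SP _ (@mpolyC #|nonzeros SJ| K)
  (fun i j => XJ (s (inl i)) (t (inl j)))); apply: (mulXP).
have X1 : X 1 by exists [:: (1, 1)]; rewrite /tens big_seq1 !rmorph1 mulr1.
rewrite mpolyXE_id; apply: (big_ind X) => [//|x y [q ->] Xy|k _].
  rewrite /tens mulr_suml; apply: (big_ind X) => // p _.
  by rewrite -mulrA; apply/mulXP/mulXQ.
elim: (m k) => [|l IH]; first by [].
by rewrite exprS; have [[i [j E]]|[i [j E]]] := symb_cases k; rewrite {1}E; [apply: mulXP|apply: mulXQ].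
Qed.

Definition projP : C -> A :=
  subst_slack SJ (@mpolyC #|nonzeros SP| K) (fun i j =>
    if (s' i, t' j) is (inl i', inl j') then XP i' j' else 1).
HB.instance Definition _ := GRing.RMorphism.on projP.

Lemma projP_embedP : cancel embedP projP.
Proof.
apply: (@slack_morph_ext _ _ _ _ _ _ (projP \o embedP) idfun).
  by move=> c /=; rewrite /embedP /projP !subst_slackC.
move=> i j Sij; have [sK _ tK _ _] := iso.
by rewrite /= embedP_symb /projP subst_slack_symb ?supp // sK tK.
Qed.

Lemma projP_symbQ i j : SQ i j != 0 -> projP (embedQ (XQ i j)) = 1.
Proof.
move=> Sij; have [sK _ tK _ _] := iso.
by rewrite embedQ_symb /projP subst_slack_symb ?supp // sK.
Qed.

(** Indexing the product by matrix position makes the block structure visible. *)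
Lemma prod_vars_symb m n (S : 'M[R]_(m, n)) :
  \prod_(k < #|nonzeros S|) 'X_k = \prod_i \prod_(j | S i j != 0) symbolic_slack K S i j.
Proof.
rewrite pair_big_dep /= (eq_bigl (fun p => p \in nonzeros S)) => [|p]; last by rewrite [RHS]inE.
rewrite [RHS]big_enum_val; apply: eq_bigr => k _.
by rewrite -symbolic_slack_val.
Qed.

Lemma prod_vars_block : \prod_(k < #|nonzeros SJ|) 'X_k =
  embedP (\prod_(k < #|nonzeros SP|) 'X_k) * embedQ (\prod_(k < #|nonzeros SQ|) 'X_k).
Proof.
have [sK sK' tK tK' _] := iso.
rewrite !prod_vars_symb (reindex s) /=; last by apply: onW_bij; exists s'.
rewrite big_sumType /= !rmorph_prod; congr (_ * _); apply: eq_bigr => i _;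
  rewrite (reindex t) /=; try (by apply: onW_bij; exists t');
  rewrite big_sumType /= rmorph_prod /=.
  rewrite [X in _ * X]big_pred0 ?mulr1 => [|j]; last by rewrite supp.
  by apply: eq_big => j; rewrite ?supp // embedP_symb.
rewrite [X in X * _]big_pred0 ?mul1r => [|j]; last by rewrite supp.
by apply: eq_big => j; rewrite ?supp // embedQ_symb.
Qed.

End Block.

(** * Chordless cycles *)

Section Cycles.
Variables (R : realType) (K : fieldType) (mP nP mQ nQ mJ nJ : nat).
Variables (SP : 'M[R]_(mP, nP)) (SQ : 'M[R]_(mQ, nQ)) (SJ : 'M[R]_(mJ, nJ)).
Variables (s : 'I_mP + 'I_mQ -> 'I_mJ) (s' : 'I_mJ -> 'I_mP + 'I_mQ).
Variables (t : 'I_nP + 'I_nQ -> 'I_nJ) (t' : 'I_nJ -> 'I_nP + 'I_nQ).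
Hypothesis iso : block_iso SP SQ SJ s s' t t'.

Local Notation embP := (@embedP R K _ _ _ _ _ _ SP SJ s t).
Local Notation embQ := (@embedQ R K _ _ _ _ _ _ SQ SJ s t).
Local Notation prP := (@projP R K _ _ _ _ _ _ SP SJ s' t').

Definition nodeP (x : 'I_mP + 'I_nP) : 'I_mJ + 'I_nJ :=
  match x with inl i => inl (s (inl i)) | inr j => inr (t (inl j)) end.

Definition isP_node (x : 'I_mJ + 'I_nJ) : bool :=
  match x with inl i => is_inl (s' i) | inr j => is_inl (t' j) end.

Lemma nodeP_inj : injective nodeP.
Proof.
have [sK _ tK _ _] := iso.
by move=> [i|j] [i'|j'] //= [E]; [have := congr1 s' E|have := congr1 t' E];
  rewrite ?sK ?tK => -[->].
Qed.

Lemma nodeP_surj x : isP_node x -> exists y, nodeP y = x.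
Proof.
have [_ sK _ tK _] := iso; case: x => [i|j] /=.
  by case E : (s' i) => [i'|//] _; exists (inl i'); rewrite /= -E sK.
by case E : (t' j) => [j'|//] _; exists (inr j'); rewrite /= -E tK.
Qed.

Lemma nonincident_nodeP x y : nonincident SJ (nodeP x) (nodeP y) = nonincident SP x y.
Proof. by have [_ _ _ _ supp] := iso; case: x y => [i|j] [i'|j'] //=; rewrite supp. Qed.

Lemma nonincident_side x y : nonincident SJ x y -> isP_node x = isP_node y.
Proof.
have [_ sK _ tK supp] := iso.
case: x y => [i|j] [i'|j'] //=.
  by rewrite -{1}(sK i) -{1}(tK j') supp; case: (s' i); case: (t' j').
by rewrite -{1}(sK i') -{1}(tK j) supp; case: (s' i'); case: (t' j).
Qed.

(** [nodeP] identifies the graph of [SP] with an induced subgraph, so chords are both preserved and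
    reflected. *)
Lemma chordless_nodeP c : chordless_cycle SJ (map nodeP c) <-> chordless_cycle SP c.
Proof.
have uc : ucycle (nonincident SJ) (map nodeP c) = ucycle (nonincident SP) c.
  rewrite /ucycle (map_inj_uniq nodeP_inj); congr (is_true (_ && _)).
  exact: (mono_cycle nonincident_nodeP).
rewrite /chordless_cycle uc size_map; split=> -[Hu Hs Hc]; have un := ucycle_uniq Hu.
  split=> // x y xc yc; rewrite -nonincident_nodeP => /Hc; rewrite !(mem_map nodeP_inj).
  by move=> /(_ xc yc); rewrite !(next_map nodeP_inj un) => -[] /nodeP_inj; [left|right].
split=> // _ _ /mapP[x xc ->] /mapP[y yc ->]; rewrite nonincident_nodeP.
by move=> /(Hc _ _ xc yc)[->|->]; [left|right]; rewrite (next_map nodeP_inj un).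
Qed.

Lemma edge_label_nodeP x y :
  edge_label K SJ (nodeP x) (nodeP y) = embP (edge_label K SP x y).
Proof.
by case: x y => [i|j] [i'|j'] /=; rewrite ?(embedP_symb K iso) ?rmorph1.
Qed.

Lemma cycle_binomial_nodeP c : uniq c ->
  cycle_binomial K SJ (map nodeP c) = embP (cycle_binomial K SP c).
Proof.
move=> un; rewrite /cycle_binomial !big_map rmorphB !rmorph_prod.
congr (_ - _); apply: eq_big => x; try by case: x.
- by rewrite (next_map nodeP_inj un) edge_label_nodeP.
- by rewrite (next_map nodeP_inj un) edge_label_nodeP.
Qed.

Lemma embedP_cycle_ideal : embP @` cycle_ideal K SP `<=` cycle_ideal K SJ.
Proof.
move=> _ [a Ta <-]; pose I : set _ := [set a | cycle_ideal K SJ (embP a)].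
suff : cycle_ideal K SP `<=` I by apply.
apply: ideal_gen_min; first exact/preimage_is_ideal/ideal_gen_is_ideal.
move=> _ [c cc <-] /=; apply: sub_ideal_gen; exists (map nodeP c).
  exact/chordless_nodeP.
by apply: cycle_binomial_nodeP; case: cc => /andP[].
Qed.

(** Adjacent nodes lie in the same block, so a cycle never leaves the block of one of its nodes. *)
Lemma chordless_cycle_side c x : chordless_cycle SJ c -> x \in c ->
  isP_node x -> exists2 c', chordless_cycle SP c' & c = map nodeP c'.
Proof.
move=> cc xc xP; have allP : {in c, forall y, isP_node y}.
  move=> y yc; have [/andP[cyc _] _ _] := cc.
  case/rot_to: xc => i p cE; have : path.cycle (nonincident SJ) (x :: p).
    by rewrite -cE rot_cycle.
  rewrite /= rcons_path => /andP[pth _].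
  have : y \in x :: p by rewrite -cE mem_rot.
  rewrite inE => /orP[/eqP -> //|].
  elim: p x {cE} xP pth => [//|z p IH] x xP /= /andP[/nonincident_side xz pth].
  by rewrite inE => /orP[/eqP ->|]; [rewrite -xz|apply: IH pth; rewrite -xz].
suff [c' E] : exists c', c = map nodeP c'.
  by exists c' => //; apply/chordless_nodeP; rewrite -E.
elim: c allP {cc xc} => [|y c IH] H; first by exists [::].
have [z zE] := nodeP_surj (H y (mem_head _ _)).
have [|c' ->] := IH; first by move=> w wc; apply: H; rewrite inE wc orbT.
by exists (z :: c'); rewrite /= zE.
Qed.

(* Every edge label of Q is sent to 1, so every cycle binomial to 1 - 1. *)
Lemma projP_join_cycle_ideal z :
  join_ideal embP embQ (cycle_ideal K SP) (cycle_ideal K SQ) z -> cycle_ideal K SP (prP z).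
Proof.
pose I : set _ := [set z | cycle_ideal K SP (prP z)].
move: z; suff : join_ideal embP embQ (cycle_ideal K SP) (cycle_ideal K SQ) `<=` I by [].
have idP : is_ideal (cycle_ideal K SP) by exact: ideal_gen_is_ideal.
apply: ideal_gen_min; first exact: preimage_is_ideal.
move=> _ [[a Ta <-]|[b Tb <-]]; rewrite /I /mkset.
  by have -> : prP (embP a) = a by exact: (projP_embedP iso).
suff -> : prP (embQ b) = 0 by case: idP.
have [g gE] : exists g : {rmorphism {mpoly K[#|nonzeros SQ|]} -> {mpoly K[#|nonzeros SP|]}},
    forall b, g b = prP (embQ b) by exists (prP \o embQ).
rewrite -gE; pose I0 : set _ := [set b | g b = 0].
suff : cycle_ideal K SQ `<=` I0 by apply.
apply: ideal_gen_min.
  apply: (@preimage_is_ideal _ _ g [set 0]); split=> //.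
    by move=> _ _ -> ->; exact: addr0.
  by move=> r _ ->; exact: mulr0.
move=> _ [c [/andP[cyc _] _ _] <-]; rewrite /I0 /mkset.
have one x : x \in c -> g (edge_label K SQ x (next c x)) = 1.
  move=> xc; have := next_cycle cyc xc; rewrite gE.
  by case: x {xc} (next c x) => [i|j] [i'|j'] //=; exact: (projP_symbQ K iso).
have prod1 (p : pred ('I_mQ + 'I_nQ)) :
    g (\prod_(x <- c | p x) edge_label K SQ x (next c x)) = 1.
  by rewrite rmorph_prod big_seq_cond big1 // => x /andP[xc _]; apply: one.
by rewrite /cycle_binomial rmorphB !prod1 subrr.
Qed.

End Cycles.

(** * The slack ideal of a join *)

Section SlackIdeal.
Variables (R : realType) (K : fieldType) (mP nP mQ nQ mJ nJ : nat).
Variables (SP : 'M[R]_(mP, nP)) (SQ : 'M[R]_(mQ, nQ)) (SJ : 'M[R]_(mJ, nJ)).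
Variables (s : 'I_mP + 'I_mQ -> 'I_mJ) (s' : 'I_mJ -> 'I_mP + 'I_mQ).
Variables (t : 'I_nP + 'I_nQ -> 'I_nJ) (t' : 'I_nJ -> 'I_nP + 'I_nQ).
Hypothesis iso : block_iso SP SQ SJ s s' t t'.

Local Notation embP := (@embedP R K _ _ _ _ _ _ SP SJ s t).
Local Notation embQ := (@embedQ R K _ _ _ _ _ _ SQ SJ s t).
Local Notation XP := (symbolic_slack K SP).
Local Notation XQ := (symbolic_slack K SQ).
Local Notation XJ := (symbolic_slack K SJ).

Lemma sub_saturation (A : comPzRingType) (I : set A) g : I `<=` saturation I g.
Proof. by move=> a Ia; exists 0%N; rewrite expr0 mul1r. Qed.

Lemma slack_ideal_is_ideal D m n (S : 'M[R]_(m, n)) : is_ideal (slack_ideal K S D).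
Proof. exact/saturation_is_ideal/ideal_gen_is_ideal. Qed.

(* A minor using many rows of P is a combination of minors within these rows,
   and those vanish unless their columns also come from P. *)
Lemma det_many_P_rows k r (rs : 'I_r -> 'I_mJ) (cs : 'I_r -> 'I_nJ) :
  (k <= #|[set i | is_inl (s' (rs i))]%SET|)%N ->
  ideal_gen (embP @` ideal_gen (minors k XP)) (\det (mxsub rs cs XJ)).
Proof.
have [_ sK _ tK _] := iso; move=> le; pose T := [set i | is_inl (s' (rs i))]%SET.
pose f (i : 'I_k) := enum_val (widen_ord (le : k <= #|T|)%N i).
have finj : injective f by move=> i j /enum_val_inj/(congr1 val)/= ?; apply: val_inj.
have /boolp.choice[rf rfE] i : exists i', s (inl i') = rs (f i).
  have := enum_valP (widen_ord (le : k <= #|T|)%N i); rewrite inE -/(f i).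
  by case E : (s' (rs (f i))) => [i'|//] _; exists i'; rewrite -E sK.
have := @laplace_rows _ _ _ k XJ (rs \o f) _ rs cs f finj (fun=> erefl).
apply: ideal_gen_min => [|_ [c _ <-]]; first exact: ideal_gen_is_ideal.
have [/boolp.choice[c' cE]|] := pselect (forall j, exists j', t (inl j') = c j).
  apply: sub_ideal_gen; exists (\det (mxsub rf c' XP)); first exact: minors_mxsub.
  rewrite -det_map_mx; congr (\det _); apply/matrixP => i j.
  transitivity (embP (XP (rf i) (c' j))); first by rewrite !mxE.
  by rewrite (embedP_symb K iso) rfE cE [RHS]mxE.
move=> /existsNP[j nj]; have [I0 _ _] := ideal_gen_is_ideal (embP @` ideal_gen (minors k XP)).
suff -> : \det (mxsub (rs \o f) c XJ) = 0 by [].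
rewrite -det_tr (expand_det_row _ j) big1 // => i _; rewrite [_^T _ _]mxE [mxsub _ _ _ _ _]mxE /=.
rewrite -rfE -(tK (c j)); case E : (t' (c j)) => [j'|j'].
  by case: nj; exists j'; rewrite -E tK.
by rewrite (symb_PQ K iso) mul0r.
Qed.

Lemma block_minor p q (rP : 'I_p -> 'I_mP) (cP : 'I_p -> 'I_nP)
    (rQ : 'I_q -> 'I_mQ) (cQ : 'I_q -> 'I_nQ) :
  ideal_gen (minors (p + q) XJ)
    (embP (\det (mxsub rP cP XP)) * embQ (\det (mxsub rQ cQ XQ))).
Proof.
pose rs i := match split i with inl i => s (inl (rP i)) | inr i => s (inr (rQ i)) end.
pose cs i := match split i with inl i => t (inl (cP i)) | inr i => t (inr (cQ i)) end.
have -> : embP (\det (mxsub rP cP XP)) * embQ (\det (mxsub rQ cQ XQ)) =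
    \det (mxsub rs cs XJ); last exact: minors_mxsub.
rewrite -!det_map_mx -(det_lblock _ 0); congr (\det _); apply/matrixP => i j.
rewrite [RHS]mxE /rs /cs -(splitK i) -(splitK j) !unsplitK.
case: (split i) => i' /=; case: (split j) => j' /=.
- rewrite block_mxEul; transitivity (embP (XP (rP i') (cP j'))); first by rewrite !mxE.
  exact: (embedP_symb K iso).
- by rewrite block_mxEur mxE (symb_PQ K iso).
- by rewrite block_mxEdl mxE (symb_QP K iso).
- rewrite block_mxEdr; transitivity (embQ (XQ (rQ i') (cQ j'))); first by rewrite !mxE.
  exact: (embedQ_symb K iso).
Qed.

Lemma dvd_prod_vars (k : 'I_#|nonzeros SQ|) :
  exists u, \prod_(i < #|nonzeros SQ|) 'X_i = 'X_k * u :> {mpoly K[#|nonzeros SQ|]}.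
Proof. by rewrite (bigD1 k) //=; eexists. Qed.

(** The determinant is the product of the [q] diagonal entries, and each is a variable dividing the
    product of all variables. *)
Lemma triangle_dvd_prod_vars q (rQ : 'I_q -> 'I_mQ) (cQ : 'I_q -> 'I_nQ) :
  (forall i, SQ (rQ i) (cQ i) != 0) ->
  (forall i j : 'I_q, (i < j)%N -> SQ (rQ i) (cQ j) = 0) ->
  exists u, (\prod_(i < #|nonzeros SQ|) 'X_i) ^+ q = \det (mxsub rQ cQ XQ) * u.
Proof.
move=> diag triang; rewrite det_trig; last first.
  apply/is_trig_mxP => i j ij; rewrite mxE; apply: symbolic_slack0; exact: triang.
have /boolp.choice[u uE] i : exists u, \prod_(i < #|nonzeros SQ|) 'X_i = XQ (rQ i) (cQ i) * u.
  have [k kE] := nonzero_index (diag i); have [u ->] := dvd_prod_vars k; exists u.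
  by rewrite -symbolic_slack_val kE.
exists (\prod_i u i); rewrite -big_split /= -[q in LHS]card_ord -prodr_const.
by apply: eq_bigr => i _; rewrite mxE; exact: uE.
Qed.

Lemma embedP_slack_ideal (d e : nat) :
  (exists (rQ : 'I_e.+1 -> 'I_mQ) (cQ : 'I_e.+1 -> 'I_nQ),
    (forall i, SQ (rQ i) (cQ i) != 0) /\
    (forall i j : 'I_e.+1, (i < j)%N -> SQ (rQ i) (cQ j) = 0)) ->
  embP @` slack_ideal K SP d `<=` slack_ideal K SJ (d + e + 1).
Proof.
move=> [rQ [cQ [diag triang]]] _ [f [N If] <-].
have [u uE] := triangle_dvd_prod_vars diag triang.
have idJ := ideal_gen_is_ideal (minors (d + e + 1 + 2) XJ); have [_ _ JM] := idJ.
pose I : set _ := [set a | ideal_gen (minors (d + e + 1 + 2) XJ)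
  (embQ (\det (mxsub rQ cQ XQ)) * embP a)].
have : I ((\prod_(k < #|nonzeros SP|) 'X_k) ^+ N * f).
  move: If; apply: ideal_gen_min.
    have [J0 JD _] := idJ; split; rewrite /I /mkset.
    - by rewrite rmorph0 mulr0.
    - by move=> a b; rewrite rmorphD mulrDr; apply: JD.
    - by move=> a b; rewrite rmorphM mulrCA; apply: JM.
  move=> _ [rP [cP [_ _ ->]]]; rewrite /I /mkset mulrC.
  have -> : (d + e + 1 + 2 = d + 2 + e.+1)%N by lia.
  exact: block_minor.
(* [N] comes from the saturation for [P]; the extra [e.+1] lets the variables of [Q] absorb the
   triangular minor, with cofactor [U]. *)
rewrite /I /mkset => H; exists (N + e.+1)%N; rewrite (prod_vars_block K iso).
have QM x y : embQ (x * y) = embQ x * embQ y by exact: rmorphM.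
have QX x k : embQ (x ^+ k) = embQ x ^+ k by exact: rmorphXn.
have PM x y : embP (x * y) = embP x * embP y by exact: rmorphM.
have PX x k : embP (x ^+ k) = embP x ^+ k by exact: rmorphXn.
move: (congr1 embQ uE) H; rewrite QX QM PM PX.
set a := embP (\prod_(_ < _) _); set b := embQ (\prod_(_ < _) _); set D := embQ (\det _).
set U := embQ u; set z := embP f => E /(JM (a ^+ e.+1 * b ^+ N * U)); congr ideal_gen.
by rewrite exprMn !exprD E; ring.
Qed.

End SlackIdeal.

(** * Both ideals of the join as sums over the two factors *)

Lemma join_idealC (K : fieldType) n1 n2 n
    (iA : {rmorphism {mpoly K[n1]} -> {mpoly K[n]}})
    (iB : {rmorphism {mpoly K[n2]} -> {mpoly K[n]}}) IA IB :
  join_ideal iA iB IA IB = join_ideal iB iA IB IA.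
Proof. by rewrite /join_ideal setUC. Qed.

Lemma join_idealS (K : fieldType) n1 n2 n
    (iA : {rmorphism {mpoly K[n1]} -> {mpoly K[n]}})
    (iB : {rmorphism {mpoly K[n2]} -> {mpoly K[n]}}) IA IB IA' IB' :
  IA `<=` IA' -> IB `<=` IB' -> join_ideal iA iB IA IB `<=` join_ideal iA iB IA' IB'.
Proof.
move=> sA sB; apply: ideal_genS => _ [[a Ia <-]|[b Ib <-]].
  by left; exists a => //; apply: sA.
by right; exists b => //; apply: sB.
Qed.

Lemma slack_ideal_saturated (R : realType) (K : fieldType) m n (S : 'M[R]_(m, n)) D N f :
  slack_ideal K S D ((\prod_(k < #|nonzeros S|) 'X_k) ^+ N * f) -> slack_ideal K S D f.
Proof. by move=> [M]; rewrite mulrA -exprD; exists (M + N)%N. Qed.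

Section BlockIdeals.
Variables (R : realType) (K : fieldType).

Section OneSide.
Variables (mP nP mQ nQ mJ nJ : nat).
Variables (SP : 'M[R]_(mP, nP)) (SQ : 'M[R]_(mQ, nQ)) (SJ : 'M[R]_(mJ, nJ)).
Variables (s : 'I_mP + 'I_mQ -> 'I_mJ) (s' : 'I_mJ -> 'I_mP + 'I_mQ).
Variables (t : 'I_nP + 'I_nQ -> 'I_nJ) (t' : 'I_nJ -> 'I_nP + 'I_nQ).
Hypothesis iso : block_iso SP SQ SJ s s' t t'.

Local Notation embP := (@embedP R K _ _ _ _ _ _ SP SJ s t).
Local Notation embQ := (@embedQ R K _ _ _ _ _ _ SQ SJ s t).

Lemma block_join_saturated IA IB g N z : is_ideal IA -> is_ideal IB ->
  (forall a, IA (g ^+ N * a) -> IA a) ->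
  join_ideal embP embQ IA IB (embP g ^+ N * z) -> join_ideal embP embQ IA IB z.
Proof.
move=> idA idB; apply: (join_ideal_saturated (coefP_embedP iso) (coefP_embedQ iso)) => //.
  exact: embed_const.
exact: (embed_tens iso).
Qed.

Lemma block_join_left IA IB a : is_ideal IA -> is_ideal IB -> ~ IB 1 ->
  join_ideal embP embQ IA IB (embP a) -> IA a.
Proof.
move=> idA idB; apply: (join_ideal_left (coefP_embedP iso) (coefP_embedQ iso)) => //.
  exact: embed_const.
exact: (embed_tens iso).
Qed.

Lemma many_P_rows_join d IB r (rs : 'I_r -> 'I_mJ) (cs : 'I_r -> 'I_nJ) :
  (d + 2 <= #|[set i | is_inl (s' (rs i))]%SET|)%N ->
  join_ideal embP embQ (slack_ideal K SP d) IB (\det (mxsub rs cs (symbolic_slack K SJ))).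
Proof.
move=> /(det_many_P_rows K iso cs); apply: ideal_genS => _ [a Ia <-].
by left; exists a => //; apply: sub_saturation.
Qed.

End OneSide.

Section TwoSides.
Variables (mP nP mQ nQ mJ nJ : nat).
Variables (SP : 'M[R]_(mP, nP)) (SQ : 'M[R]_(mQ, nQ)) (SJ : 'M[R]_(mJ, nJ)).
Variables (s : 'I_mP + 'I_mQ -> 'I_mJ) (s' : 'I_mJ -> 'I_mP + 'I_mQ).
Variables (t : 'I_nP + 'I_nQ -> 'I_nJ) (t' : 'I_nJ -> 'I_nP + 'I_nQ).
Hypothesis iso : block_iso SP SQ SJ s s' t t'.

Local Notation embP := (@embedP R K _ _ _ _ _ _ SP SJ s t).
Local Notation embQ := (@embedQ R K _ _ _ _ _ _ SQ SJ s t).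

Lemma slack_ideal_block_sub d e :
  slack_ideal K SJ (d + e + 1) `<=`
  join_ideal embP embQ (slack_ideal K SP d) (slack_ideal K SQ e).
Proof.
have isoC := block_iso_swap iso.
have idP := @slack_ideal_is_ideal R K d _ _ SP.
have idQ := @slack_ideal_is_ideal R K e _ _ SQ.
move=> f [N Jf].
have {Jf} : join_ideal embP embQ (slack_ideal K SP d) (slack_ideal K SQ e)
    ((\prod_(k < #|nonzeros SJ|) 'X_k) ^+ N * f).
  move: Jf; apply: ideal_gen_min; first exact: ideal_gen_is_ideal.
  move=> _ [rs [cs [_ _ ->]]].
  pose U := [set i | is_inl (s' (rs i))]%SET.
  have [leP|ltP] := leqP (d + 2) #|U|; first exact: (many_P_rows_join iso).
  (* With at most [d + 1] of the [d + e + 3] rows in [P], at least [e + 2] lie in [Q]. *)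
  rewrite join_idealC; apply: (many_P_rows_join isoC).
  have -> : [set i | is_inl ((@sum_swap _ _ \o s') (rs i))]%SET = (~: U)%SET.
    by apply/setP => i; rewrite !inE /=; case: (s' (rs i)).
  by have := cardsC U; rewrite card_ord; lia.
(* The product of all variables splits by block, and each factor is cancelled by the saturation of
   its own ideal. *)
rewrite (prod_vars_block K iso) exprMn -mulrA.
move=> /(block_join_saturated iso idP idQ (@slack_ideal_saturated _ _ _ _ _ _ _)).
rewrite join_idealC.
by move=> /(block_join_saturated isoC idQ idP (@slack_ideal_saturated _ _ _ _ _ _ _)).
Qed.

Lemma slack_ideal_block d e :
  (exists (r : 'I_d.+1 -> 'I_mP) (c : 'I_d.+1 -> 'I_nP),
    (forall i, SP (r i) (c i) != 0) /\
    (forall i j : 'I_d.+1, (i < j)%N -> SP (r i) (c j) = 0)) ->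
  (exists (r : 'I_e.+1 -> 'I_mQ) (c : 'I_e.+1 -> 'I_nQ),
    (forall i, SQ (r i) (c i) != 0) /\
    (forall i j : 'I_e.+1, (i < j)%N -> SQ (r i) (c j) = 0)) ->
  slack_ideal K SJ (d + e + 1) =
  join_ideal embP embQ (slack_ideal K SP d) (slack_ideal K SQ e).
Proof.
move=> triP triQ; apply/seteqP; split; first exact: slack_ideal_block_sub.
apply: ideal_gen_min; first exact: slack_ideal_is_ideal.
move=> z [Pz|Qz]; first exact: (embedP_slack_ideal iso triQ).
rewrite [(d + e)%N]addnC.
exact: (embedP_slack_ideal (block_iso_swap iso) triP).
Qed.

Lemma cycle_ideal_block :
  cycle_ideal K SJ = join_ideal embP embQ (cycle_ideal K SP) (cycle_ideal K SQ).
Proof.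
have isoC := block_iso_swap iso; apply/seteqP; split; last first.
  apply: ideal_gen_min; first exact: ideal_gen_is_ideal.
  move=> z [Pz|Qz]; first exact: (embedP_cycle_ideal iso).
  exact: (embedP_cycle_ideal isoC).
apply: ideal_gen_min; first exact: ideal_gen_is_ideal.
move=> _ [c cc <-]; have [x xc] : exists x, x \in c.
  by case: (c) cc => [[]//|x c' _]; exists x; exact: mem_head.
have [xP|xQ] := boolP (isP_node s' t' x).
  have [c' cc' cE] := chordless_cycle_side iso cc xc xP.
  have un : uniq c' by case: cc' => /ucycle_uniq.
  rewrite cE (cycle_binomial_nodeP K iso un); apply: sub_ideal_gen; left.
  by eexists; [apply: sub_ideal_gen; exists c'|].
have {}xQ : isP_node (@sum_swap _ _ \o s') (@sum_swap _ _ \o t') x.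
  by case: x xQ {xc} => [i|j] /=; [case: (s' i)|case: (t' j)].
have [c' cc' cE] := chordless_cycle_side isoC cc xc xQ.
have un : uniq c' by case: cc' => /ucycle_uniq.
rewrite cE (cycle_binomial_nodeP K isoC un); apply: sub_ideal_gen; right.
by eexists; [apply: sub_ideal_gen; exists c'|].
Qed.

End TwoSides.
End BlockIdeals.

(** * Transfer of the inclusions between the join and its factors *)

Theorem theorem3p6
  (R : realType) (K : fieldType) (charK : [pchar K] =i pred0)
  (d e : nat) (P : set 'rV[R]_d) (Q : set 'rV[R]_e) (J : set 'rV[R]_(d + e + 1))
  (polyP : is_polytope P) (fullP : full_dimensional P)
  (polyQ : is_polytope Q) (fullQ : full_dimensional Q)
  (joinPQ : is_join P Q J)
  (mP nP mQ nQ mJ nJ : nat)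
  (SP : 'M[R]_(mP, nP)) (slackP : is_slack_matrix P SP)
  (SQ : 'M[R]_(mQ, nQ)) (slackQ : is_slack_matrix Q SQ)
  (SJ : 'M[R]_(mJ, nJ)) (slackJ : is_slack_matrix J SJ) :
  [/\ slack_ideal K SJ (d + e + 1) `<=` cycle_ideal K SJ <->
        slack_ideal K SP d `<=` cycle_ideal K SP /\
        slack_ideal K SQ e `<=` cycle_ideal K SQ,
      cycle_ideal K SJ `<=` slack_ideal K SJ (d + e + 1) <->
        cycle_ideal K SP `<=` slack_ideal K SP d /\
        cycle_ideal K SQ `<=` slack_ideal K SQ e &
      graphic K SJ (d + e + 1) <-> graphic K SP d /\ graphic K SQ e].
Proof.
have [s [t [[s' sK sK'] [t' tK tK'] supp]]] := join_support fullP fullQ joinPQ slackP slackQ slackJ.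
have iso : block_iso SP SQ SJ s s' t t' by [].
have isoC := block_iso_swap iso.
have IJ := slack_ideal_block K iso (slack_triangle polyP fullP slackP)
  (slack_triangle polyQ fullQ slackQ).
have TJ := cycle_ideal_block K iso.
have noP := one_notin_slack_ideal charK slackP.
have noQ := one_notin_slack_ideal charK slackQ.
have idIP := @slack_ideal_is_ideal R K d _ _ SP.
have idIQ := @slack_ideal_is_ideal R K e _ _ SQ.
have embI a : slack_ideal K SP d a -> slack_ideal K SJ (d + e + 1) (embedP SJ s t a).
  by move=> Ia; rewrite IJ; apply: sub_ideal_gen; left; exists a.
have embIQ b : slack_ideal K SQ e b -> slack_ideal K SJ (d + e + 1) (embedQ SJ s t b).
  by move=> Ib; rewrite IJ; apply: sub_ideal_gen; right; exists b.
have embT a : cycle_ideal K SP a -> cycle_ideal K SJ (embedP SJ s t a).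
  by move=> Ta; rewrite TJ; apply: sub_ideal_gen; left; exists a.
have embTQ b : cycle_ideal K SQ b -> cycle_ideal K SJ (embedQ SJ s t b).
  by move=> Tb; rewrite TJ; apply: sub_ideal_gen; right; exists b.
have ab : slack_ideal K SJ (d + e + 1) `<=` cycle_ideal K SJ <->
    slack_ideal K SP d `<=` cycle_ideal K SP /\ slack_ideal K SQ e `<=` cycle_ideal K SQ.
  split=> [sub|[subP subQ]]; last by rewrite IJ TJ; exact: join_idealS.
  split=> a Ia.
    (* The embedded element is sent back to [a] by the retraction, which maps the cycle ideal of the
       join into that of [P]. *)
    have /sub := embI a Ia; rewrite TJ => /(projP_join_cycle_ideal iso).
    by rewrite (projP_embedP iso).
  have /sub := embIQ a Ia; rewrite TJ join_idealC => /(projP_join_cycle_ideal isoC).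
  by rewrite (projP_embedP isoC).
have ba : cycle_ideal K SJ `<=` slack_ideal K SJ (d + e + 1) <->
    cycle_ideal K SP `<=` slack_ideal K SP d /\ cycle_ideal K SQ `<=` slack_ideal K SQ e.
  split=> [sub|[subP subQ]]; last by rewrite IJ TJ; exact: join_idealS.
  split=> a Ta.
    (* Here the slack ideal is contracted to the ring of [P], which relies on [noQ]. *)
    have /sub := embT a Ta; rewrite IJ; exact: (block_join_left iso).
  have /sub := embTQ a Ta; rewrite IJ join_idealC; exact: (block_join_left isoC).
split=> //; split=> [E|[EP EQ]].
  have [|aP aQ] := ab.1; first by rewrite E.
  have [|bP bQ] := ba.1; first by rewrite E.
  by split; apply/seteqP.
by apply/seteqP; split; [apply/ab|apply/ba]; split; rewrite ?EP ?EQ.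
Qed.
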